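(* Let $X_1,X_2,\dots$ be i.i.d. $\mathbb{Z}$-valued random variables on a probability space $(\Omega,\mathcal{F},P)$ satisfying conditions (A1), (A2), (A3) below, and let $\beta\in(0,2]$, $c_*>0$, $\varepsilon>0$ be the constants in (A3). For each $N\in\mathbb{N}$, let $\mathcal{R}^{(N)}_n$ and $\mathbb{P}^{(N)}_{\mathcal{R}}$ be as described in the context. (I) If $\beta\in(0,1)$, then there is a constant $c_1>0$ such that for every $N\in\mathbb{N}\setminus\{1\}$ and all $y_1,\dots,y_N\in\mathbb{Z}$ with $|y_n-y_{n+1}|\le 1$ for $n=1,\dots,N-1$, $$c_1\le \mathbb{P}^{(N)}_{\mathcal{R}}\Big(\bigcup_{n=1}^N\{\mathcal{R}^{(N)}_n=(y_n \bmod N)\}\Big).$$ (II) If $\beta=1$, then there are constants $c_2>0$, $c_3>0$ such that for every $N\in\mathbb{N}\setminus\{1\}$ and all $y_1,\dots,y_N\in\mathbb{Z}$ with $|y_n-y_{n+1}|\le 1$ for $n=1,\dots,N-1$, $$\frac{1}{\frac{1}{c_*\pi}\log N+c_2}\le \mathbb{P}^{(N)}_{\mathcal{R}}\Big(\bigcup_{n=1}^N\{\mathcal{R}^{(N)}_n=(y_n \bmod N)\}\Big)\le\frac{c_3}{\log N}.$$ (III) If $\beta\in(1,2]$, then there is a constant $c_4>0$ such that for every $N\in\mathbb{N}\setminus\{1\}$ and all $y_1,\dots,y_N\in\mathbb{Z}$ with $|y_n-y_{n+1}|\le 1$ for $n=1,\dots,N-1$, $$\frac{c_4}{N^{(\beta-1)/\beta}}\le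 \mathbb{P}^{(N)}_{\mathcal{R}}\Big(\bigcup_{n=1}^N\{\mathcal{R}^{(N)}_n=(y_n \bmod N)\}\Big).$$
   Context: $S_n=\sum_{j=1}^n X_j$. For $N\in\mathbb{N}$, $V_N=\{0,1,\dots,N-1\}$ and $X^{(N)}_0$ is a random variable on a probability space $(\Omega_N,\mathcal{F}_N,\mu_N)$ uniformly distributed on $V_N$. For $b\in\mathbb{Z}$, $(b\bmod N)\in V_N$ denotes the remainder of $b$ divided by $N$. The rabbit's position is $\mathcal{R}^{(N)}_0=X^{(N)}_0$ and $\mathcal{R}^{(N)}_n=(X^{(N)}_0+S_n \bmod N)$, and $\mathbb{P}^{(N)}_{\mathcal{R}}=\mu_N\times P$ (product measure, so $X^{(N)}_0$ is independent of the walk). The characteristic function is $\phi(\theta)=\sum_{k\in\mathbb{Z}}e^{i\theta k}P\{X_1=k\}$. (A1) Strong aperiodicity: for each $y\in\mathbb{Z}$, the smallest subgroup of $\mathbb{Z}$ containing $\{y+k: P\{X_1=k\}>0\}$ is $\mathbb{Z}$. (A2) Symmetry: $P\{X_1=k\}=P\{X_1=-k\}$ for all $k\in\mathbb{Z}$. (A3) There exist $\beta\in(0,2]$, $c_*>0$ and $\varepsilon>0$ such that $\phi(\theta)=1-c_*|\theta|^\beta+O(|\theta|^{\beta+\varepsilon})$ as $\theta\to0$. The constants $c_1,\dots,c_4$ may depend on the law of $X_1$ but not on $N$ or the $y_n$. *)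

(* Defs.v *)
From HB Require Import structures.
From mathcomp Require Import all_boot all_order all_algebra.
From mathcomp Require Import all_classical all_reals all_analysis.
Set Implicit Arguments. Unset Strict Implicit. Unset Printing Implicit Defensive.
Import Order.TTheory GRing.Theory Num.Theory.
Import numFieldNormedType.Exports.
Local Open Scope classical_set_scope.
Local Open Scope ring_scope.

Section Defs.
Variables (d : measure_display) (T : measurableType d) (R : realType).
Variable (P : probability T R).
Variable (X : nat -> T -> int).

Definition iid_discrete_rvs : Prop :=
  forall j, (1 <= j)%N -> forall A : set int, measurable (X j @^-1` A).

Definition iid_ident_distr : Prop :=
  forall j, (1 <= j)%N -> forall A : set int, P (X j @^-1` A) = P (X 1 @^-1` A).

Definition iid_mutually_indep : Prop :=
  forall (s : seq nat) (A : nat -> set int),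
    uniq s -> all (fun j => (1 <= j)%N) s ->
    P (\big[setI/setT]_(j <- s) (X j @^-1` A j)) =
    (\prod_(j <- s) P (X j @^-1` A j))%E.

Definition step_law (k : int) : R := fine (P (X 1 @^-1` [set k])).

Definition walk_S (n : nat) (w : T) : int := \sum_(1 <= j < n.+1) X j w.

(* P^{(N)}_R ( \bigcup_{n=1}^N { R^{(N)}_n = (y_n mod N) } ), with the
   product measure mu_N x P written out (mu_N uniform on V_N). *)
Definition hit_prob (N : nat) (y : nat -> int) : R :=
  (N%:R)^-1 * \sum_(x0 < N)
    fine (P [set w | exists n : nat, [/\ (1 <= n)%N, (n <= N)%N &
               ((x0%:Z + walk_S n w) %% N%:Z)%Z = ((y n) %% N%:Z)%Z]]).
End Defs.

(* Summation over Z of an absolutely summable family, as the limit of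
   symmetric partial sums  sum_{|k| <= n} f k. *)
Definition zsum (R : realType) (f : int -> R) : R :=
  limn (fun n : nat => \sum_(i < n.*2.+1) f (i%:Z - n%:Z)).

(* Characteristic function phi(theta) = sum_k e^{i theta k} p(k),
   via its real and imaginary parts. *)
Definition phi_re (R : realType) (p : int -> R) (th : R) : R :=
  zsum (fun k => p k * cos (th * k%:~R)).
Definition phi_im (R : realType) (p : int -> R) (th : R) : R :=
  zsum (fun k => p k * sin (th * k%:~R)).

Definition subgroupZ (G : set int) : Prop :=
  G 0 /\ forall a b, G a -> G b -> G (a - b).

Definition strongly_aperiodic (R : realType) (p : int -> R) : Prop :=
  forall y : int, forall G : set int, subgroupZ G ->
    (forall k, 0 < p k -> G (y + k)) -> G = setT.

Definition symmetric_law (R : realType) (p : int -> R) : Prop :=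
  forall k, p k = p (- k).

(* (A3): phi(theta) = 1 - c |theta|^beta + O(|theta|^(beta+eps)) as theta -> 0,
   the O-term measured by the complex modulus. *)
Definition A3 (R : realType) (p : int -> R) (beta cst eps : R) : Prop :=
  [/\ 0 < beta, beta <= 2, 0 < cst, 0 < eps &
   exists C delta : R, 0 < C /\ 0 < delta /\
     forall th : R, `|th| < delta ->
       Num.sqrt ((phi_re p th - (1 - cst * (`|th| `^ beta))) ^+ 2 + (phi_im p th) ^+ 2)
         <= C * (`|th| `^ (beta + eps))].

(* Main.v *)
Require Import Defs.
From HB Require Import structures.
From mathcomp Require Import all_boot all_order all_algebra.
From mathcomp Require Import all_classical all_reals all_analysis.
From mathcomp Require Import ring lra zify.
Import Order.TTheory GRing.Theory Num.Theory.
Import numFieldNormedType.Exports.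
Local Open Scope classical_set_scope.
Local Open Scope ring_scope.
Set Implicit Arguments. Unset Strict Implicit. Unset Printing Implicit Defensive.

(** Let [q_m a] be the probability that [S_m = a] modulo [N]. The starting point
    being uniform, each time gives a hit with probability [1/N], so the expected
    number of hits up to time [N] is [1]. Restarting at the first hit compares
    the hitting probability with the expected number of hits after a hit, a sum
    [sum_m q_m (a_m)]. Fourier inversion on [Z/N] reads
    [q_m a = 1/N sum_j phi(t_j)^m cos(t_j a)] with [t_j = 2 pi j / N].

    For the lower bounds, [q_m] is at most [1/N sum_j |phi(t_j)|^m]; summing over
    [m <= N] leaves [1/N sum_j min(N, 1/(1 - |phi(t_j)|))], which (A3) near [0] and
    strong aperiodicity away from [0] estimate.

    For the upper bound when [beta = 1], [phi(t_j)^m] is compared with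
    [r^j + r^(N-j)], [r = exp(-2 pi c m / N)], whose cosine sum is a Poisson kernel
    in closed form. This gives [q_m a >= kappa / m] for [|a| <= m <= N] and [m]
    large, hence at least of order [log N] expected hits after a hit, while the
    expected number of hits up to time [2N] is [2]. *)

(** * Elementary estimates *)

(** The rate [log N] at [beta = 1] rests on a coincidence of scales: after [m] steps the walk is
    spread over distances of order [m], which is also the farthest the path [y] can have moved, so
    the walk still charges the current target with mass of order [1/m]. On the Fourier side, the
    Poisson kernel with [1 - r] of order [m/N] has height of order [N/m], kept as long as
    [|a| <= m]. The error in replacing [phi^m] must then sum to less than [N/m] over all
    frequencies; [exp (- c theta)] is a suitable model since its [m]-th power is geometric in [j],
    and [r^(N-j)] accounts for the frequencies close to [2 pi].

    The sharp constant [1/(c pi)] in the lower bound asks for [1/(1 - |phi|) = 1/(c theta)] up to an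
    error whose average over the angles stays bounded in [N]. For [beta] other than [1] only orders
    of magnitude matter.

    The restart at the first hit involves no stopping time: hitting probabilities and expected
    visits obey the same one-step recursion on residues, and independence enters only through finite
    products. *)

Section RealEstimates.
Variable R : realType.
Implicit Types (x y t s e : R).

Lemma ger_one_sub_expRN x : 0 <= x -> x / (1 + x) <= 1 - expR (- x).
Proof.
move=> x0; rewrite expRN; have H := expR_ge1Dx x.
have : (expR x)^-1 <= (1 + x)^-1 by rewrite lef_pV2 ?posrE ?expR_gt0 //; lra.
suff : x / (1 + x) = 1 - (1 + x)^-1 by lra.
by field; rewrite gt_eqF //; lra.
Qed.

Lemma expRN_quadratic x : 0 <= x -> `|expR (- x) - (1 - x)| <= x ^+ 2.
Proof.
move=> x0; have H1 := expR_ge1Dx (- x); have H2 := ger_one_sub_expRN x0.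
rewrite ger0_norm; last by lra.
suff : x - x / (1 + x) <= x ^+ 2 by lra.
have -> : x - x / (1 + x) = x ^+ 2 / (1 + x) by field; rewrite gt_eqF //; lra.
by rewrite ler_pdivrMr; [nra|lra].
Qed.

(** Since [1 + e <= 2], it suffices to square [1 + y <= (1 + 2 / mu) (1 + mu y / 2)], whose last
    factor is at most [expR (mu * y / 2)]. *)
Lemma powR_le_expR e mu : 0 <= e <= 1 -> 0 < mu ->
  exists2 K : R, 0 < K & forall y, 0 <= y -> y `^ (1 + e) <= K * expR (mu * y).
Proof.
move=> /andP[e0 e1] mu0; exists ((1 + 2 / mu) ^+ 2).
  by rewrite exprn_gt0 // addr_gt0 ?divr_gt0.
move=> y y0; apply: (@le_trans _ _ ((1 + y) `^ (1 + e))).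
  by apply: ge0_ler_powR; rewrite ?nnegrE; lra.
apply: (@le_trans _ _ ((1 + y) `^ 2)).
  by apply: ler_powR; lra.
rewrite powR_mulrn; last lra.
have -> : expR (mu * y) = expR (mu * y / 2) ^+ 2.
  by rewrite -expRM_natl; congr expR; field.
rewrite -exprMn; apply: lerXn2r; rewrite ?nnegrE; try lra.
  by rewrite mulr_ge0 ?expR_ge0 // addr_ge0 // divr_ge0 // ltW.
apply: (@le_trans _ _ ((1 + 2 / mu) * (1 + mu * y / 2))).
  have -> : (1 + 2 / mu) * (1 + mu * y / 2) = 1 + y + (2 / mu + mu * y / 2).
    by field; rewrite gt_eqF.
  by rewrite lerDl addr_ge0 // divr_ge0 ?mulr_ge0 // ltW.
by rewrite ler_wpM2l ?expR_ge1Dx // addr_ge0 // divr_ge0 // ltW.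
Qed.

Lemma ler_dist_exprn (a b M : R) m : 0 <= a <= M -> 0 <= b <= M ->
  `|a ^+ m - b ^+ m| <= m%:R * `|a - b| * M ^+ m.-1.
Proof.
move=> /andP[a0 aM] /andP[b0 bM]; rewrite subrXX normrM.
rewrite [leRHS]mulrAC [leRHS]mulrC ler_wpM2l // ger0_norm; last first.
  by apply: sumr_ge0 => i _; rewrite mulr_ge0 ?exprn_ge0.
apply: (@le_trans _ _ (\sum_(i < m) M ^+ m.-1)); last first.
  by rewrite sumr_const card_ord mulr_natl.
apply: ler_sum => i _.
have -> : M ^+ m.-1 = M ^+ (m.-1 - i) * M ^+ i.
  by rewrite -exprD subnK //; have := ltn_ord i; lia.
by apply: ler_pM; rewrite ?exprn_ge0 // lerXn2r ?nnegrE //; apply: le_trans _ aM.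
Qed.

Lemma normr_sin_le x : `|sin x| <= `|x|.
Proof.
wlog x0 : x / 0 <= x.
  move=> H; have [|xn] := leP 0 x; first exact: H.
  by rewrite -normrN -sinN -[leRHS]normrN; apply: H; rewrite oppr_ge0 ltW.
have [->|xn] := eqVneq x 0; first by rewrite sin0.
have xp : 0 < x by rewrite lt_neqAle eq_sym xn.
have [|c _] := @MVT R sin cos 0 x xp (fun z _ => is_derive_sin z).
  by apply: continuous_subspaceT; exact: continuous_sin.
by rewrite sin0 !subr0 => ->; rewrite normrM ler_piMl ?cos_max.
Qed.

Lemma one_sub_cos_le x : 2 * (1 - cos x) <= x ^+ 2.
Proof.
have -> : cos x = 1 - 2 * sin (x / 2) ^+ 2.
  have -> : x = (x / 2) *+ 2 by rewrite -mulr_natr; field.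
  by rewrite cos_mulr2n -mulr_natr (_ : (x / 2) *+ 2 / 2 = x / 2) ?cos2sin2;
    [ring|rewrite -mulr_natr; field].
have : sin (x / 2) ^+ 2 <= (x / 2) ^+ 2.
  rewrite -[leLHS]real_normK ?num_real // -[leRHS]real_normK ?num_real //.
  by rewrite lerXn2r ?nnegrE // normr_sin_le.
have -> : (x / 2) ^+ 2 = x ^+ 2 / 4 by field.
lra.
Qed.

Lemma powR_small (a b : R) : 0 < a -> 0 < b ->
  exists2 d : R, 0 < d & forall t, 0 <= t <= d -> t `^ a <= b.
Proof.
move=> a0 b0; exists (b `^ a^-1); first exact: powR_gt0.
move=> t /andP[t0 tb]; rewrite -[leRHS]powRr1 ?(ltW b0) // -(mulVf (lt0r_neq0 a0)) powRrM.
by apply: ge0_ler_powR; rewrite ?nnegrE ?powR_ge0 // ltW.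
Qed.

Lemma inv_le_ln_diff (j : nat) : (0 < j)%N -> j.+1%:R^-1 <= ln j.+1%:R - ln j%:R :> R.
Proof.
move=> j0; have jR : 0 < j%:R :> R by rewrite ltr0n.
have jS : 0 < j.+1%:R :> R by rewrite ltr0n.
have : ln (1 + - j.+1%:R^-1) <= - j.+1%:R^-1 :> R.
  by apply: le_ln1Dx; rewrite ltrN2 invf_lt1 // ltr1n.
have -> : 1 + - j.+1%:R^-1 = j%:R / j.+1%:R :> R.
  by rewrite -natr1; field; rewrite natr1 gt_eqF.
by rewrite ln_div ?posrE // lerNr opprB.
Qed.

Lemma ln_diff_le_inv (j : nat) : (0 < j)%N -> ln j.+1%:R - ln j%:R <= j%:R^-1 :> R.
Proof.
move=> j0; have jR : 0 < j%:R :> R by rewrite ltr0n.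
have jS : 0 < j.+1%:R :> R by rewrite ltr0n.
have : ln (1 + j%:R^-1) <= j%:R^-1 :> R.
  by apply: le_ln1Dx; apply: lt_trans (_ : 0 < _); rewrite ?invr_gt0 // ltrN10.
have -> : 1 + j%:R^-1 = j.+1%:R / j%:R :> R.
  by rewrite -natr1; field; rewrite gt_eqF.
by rewrite ln_div ?posrE.
Qed.

Lemma harmonic_le N : (0 < N)%N -> \sum_(1 <= j < N) j%:R^-1 <= 1 + ln N%:R :> R.
Proof.
have H n : \sum_(1 <= j < n.+2) j%:R^-1 <= 1 + ln n.+1%:R :> R.
  elim: n => [|n IH]; first by rewrite big_nat1 invr1 ln1 addr0.
  rewrite big_nat_recr //=; apply: le_trans (lerD IH (inv_le_ln_diff (ltn0Sn n))) _.
  by rewrite -addrA [_ + (_ - _)]addrC subrK.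
case: N => // -[|n] _; first by rewrite big_geq // ln1 addr0.
by apply: le_trans (H n) _; rewrite lerD2l ler_ln ?posrE ?ltr0n // ler_nat.
Qed.

Lemma harmonic_ge m N : (0 < m)%N -> (m <= N)%N ->
  ln N%:R - ln m%:R <= \sum_(m <= j < N) j%:R^-1 :> R.
Proof.
move=> m0; elim: N => [|N IH]; first by lia.
rewrite leq_eqVlt => /orP[/eqP <-|mN]; first by rewrite subrr big_geq.
have N0 : (0 < N)%N by lia.
rewrite (@big_nat_recr _ _ _ N) //=; apply: le_trans (lerD (IH mN) (ln_diff_le_inv N0)).
by rewrite addrAC [ln N%:R + _]addrC subrK.
Qed.

(** Discrete form of the derivative of [x^s / s]. The factor 2 pays for the linear bound
    [(1 - u)^s <= 1 - s u / 2], reached through [expR (- (s * u))] and [s * u <= 1]. *)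
Lemma powR_diff_ge s (j : nat) : 0 < s < 1 ->
  j.+1%:R `^ (s - 1) <= 2 / s * (j.+1%:R `^ s - j%:R `^ s).
Proof.
move=> /andP[s0 s1]; have jS : 0 < j.+1%:R :> R by rewrite ltr0n.
have -> : j.+1%:R `^ (s - 1) = j.+1%:R `^ s * j.+1%:R^-1.
  by rewrite powRD ?powR_inv1 // ?ltW //; apply/implyP => _; rewrite gt_eqF.
pose u : R := j.+1%:R^-1; rewrite -/u.
have u0 : 0 < u by rewrite invr_gt0.
have u1 : u <= 1 by rewrite invf_le1 // ler1n.
have jE : j%:R = j.+1%:R * (1 - u) by rewrite mulrBr mulr1 mulfV ?gt_eqF // -natr1 addrK.
have -> : j%:R `^ s = j.+1%:R `^ s * (1 - u) `^ s.
  by rewrite jE powRM ?subr_ge0 ?ler0n.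
suff H : (1 - u) `^ s <= 1 - s * u / 2.
  have A0 : 0 < j.+1%:R `^ s :> R by exact: powR_gt0.
  have -> : 2 / s * (j.+1%:R `^ s - j.+1%:R `^ s * (1 - u) `^ s) =
     j.+1%:R `^ s * (2 / s * (1 - (1 - u) `^ s)) by ring.
  rewrite ler_wpM2l ?(ltW A0) //.
  have {1}-> : u = 2 / s * (s * u / 2) by field; rewrite gt_eqF.
  by rewrite ler_wpM2l ?divr_ge0 ?(ltW s0) //; lra.
have su : 0 < s * u by exact: mulr_gt0.
have su1 : s * u <= 1 by rewrite mulr_ile1 // ltW.
apply: (@le_trans _ _ (expR (- (s * u)))); last first.
  have H := ger_one_sub_expRN (ltW su).
  suff : s * u / 2 <= s * u / (1 + s * u) by lra.
  by rewrite ler_wpM2l ?(ltW su) // lef_pV2 ?posrE //; lra.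
(* [u = 1] is the case [j = 0], which the logarithm used below cannot treat. *)
have [E|ne] := eqVneq u 1.
  by rewrite E subrr powR0 ?gt_eqF ?expR_ge0.
have u1' : u < 1 by rewrite lt_neqAle ne.
rewrite /powR gt_eqF ?subr_gt0 // ler_expR -mulrN ler_wpM2l ?(ltW s0) //.
by have := @le_ln1Dx R (- u); apply; lra.
Qed.

Lemma sum_powR_le s N : 0 < s < 1 ->
  \sum_(1 <= j < N) j%:R `^ (s - 1) <= 2 / s * N%:R `^ s :> R.
Proof.
move=> s01; have /andP[s0 _] := s01; have s2 : 0 <= 2 / s by rewrite divr_ge0 ?ltW.
have H n : \sum_(1 <= j < n.+1) j%:R `^ (s - 1) <= 2 / s * n%:R `^ s :> R.
  elim: n => [|n IH]; first by rewrite big_geq // mulr_ge0 ?powR_ge0.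
  by rewrite big_nat_recr //=; have := powR_diff_ge n s01; rewrite mulrBr; lra.
case: N => [|n]; first by rewrite big_geq // mulr_ge0 ?powR_ge0.
apply: le_trans (H n) _; rewrite ler_wpM2l //.
by apply: ge0_ler_powR; rewrite ?nnegrE ?(ltW s0) // ler_nat.
Qed.

(** Reduces to the Bernoulli-type inequality [1 + t u <= (1 - u)^(- t)] with [u = 1 / (j + 1)]. *)
Lemma powR_diff_tail t (j : nat) : 0 < t -> (0 < j)%N ->
  j.+1%:R `^ (- (1 + t)) <= t^-1 * (j%:R `^ (- t) - j.+1%:R `^ (- t)) :> R.
Proof.
move=> t0 j0; have jS : 0 < j.+1%:R :> R by rewrite ltr0n.
have jR : 0 < j%:R :> R by rewrite ltr0n.
have -> : j.+1%:R `^ (- (1 + t)) = j.+1%:R `^ (- t) * j.+1%:R^-1 :> R.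
  by rewrite opprD addrC powRD ?powR_inv1 // ?ltW //; apply/implyP => _; rewrite gt_eqF.
pose u : R := j.+1%:R^-1; rewrite -/u.
have u0 : 0 < u by rewrite invr_gt0.
have u1 : u < 1 by rewrite invf_lt1 // ltr1n.
have jE : j%:R = j.+1%:R * (1 - u) by rewrite mulrBr mulr1 mulfV ?gt_eqF // -natr1 addrK.
have -> : j%:R `^ (- t) = j.+1%:R `^ (- t) * (1 - u) `^ (- t).
  by rewrite jE powRM ?subr_ge0 ?ler0n ?(ltW u1).
have A0 : 0 < j.+1%:R `^ (- t) :> R by exact: powR_gt0.
have -> : t^-1 * (j.+1%:R `^ (- t) * (1 - u) `^ (- t) - j.+1%:R `^ (- t)) =
   j.+1%:R `^ (- t) * (t^-1 * ((1 - u) `^ (- t) - 1)) by ring.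
rewrite ler_wpM2l ?(ltW A0) // ler_pdivlMl // mulrC.
rewrite /powR gt_eqF ?subr_gt0 //.
have := expR_ge1Dx (- t * ln (1 - u)).
suff : u * t <= - t * ln (1 - u) by lra.
rewrite mulNr -mulrN mulrC ler_wpM2l ?(ltW t0) //.
by have := @le_ln1Dx R (- u); rewrite ltrN2 => /(_ u1); lra.
Qed.

Lemma sum_powR_tail t (J N : nat) : 0 < t -> (0 < J)%N ->
  \sum_(J.+1 <= j < N) j%:R `^ (- (1 + t)) <= t^-1 * J%:R `^ (- t) :> R.
Proof.
move=> t0 J0.
have ti : 0 <= t^-1 by rewrite invr_ge0 ltW.
have [NJ|JN] := leqP N J.+1; first by rewrite big_geq // mulr_ge0 ?powR_ge0.
suff H n : (J <= n)%N -> \sum_(J.+1 <= j < n.+1) j%:R `^ (- (1 + t)) <=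
    t^-1 * (J%:R `^ (- t) - n%:R `^ (- t)) :> R.
  case: N JN => // n JN; apply: le_trans (H n _) _; first by lia.
  by rewrite ler_wpM2l // gerBl powR_ge0.
elim: n => [|n IH]; first by lia.
rewrite leq_eqVlt => /orP[/eqP <-|Jn]; first by rewrite big_geq // subrr mulr0.
have n0 : (0 < n)%N by lia.
rewrite (@big_nat_recr _ _ _ n.+1) //=.
have := powR_diff_tail t0 n0; have := IH Jn; rewrite !mulrBr; lra.
Qed.

Lemma sum_expr_le x M : 0 <= x < 1 -> \sum_(m < M) x ^+ m <= (1 - x)^-1.
Proof.
move=> /andP[x0 x1]; have x1' : 0 < 1 - x by rewrite subr_gt0.
rewrite -[leRHS]mul1r ler_pdivlMr // mulrC.
have -> : (1 - x) * \sum_(m < M) x ^+ m = 1 - x ^+ M.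
  by rewrite -[RHS]opprB subrX1 -mulNr opprB.
by rewrite gerBl exprn_ge0.
Qed.

End RealEstimates.

(** * The walk modulo N *)

Section ResidueWalk.
Variables (R : realType) (N : nat) (pr : nat -> R) (y : nat -> int).
Hypothesis N0 : (0 < N)%N.
Hypothesis pr_ge0 : forall b, 0 <= pr b.
Hypothesis pr_sum1 : \sum_(b < N) pr b = 1.

(** The [m]-fold convolution power of [pr] on Z/N, evaluated at an integer representative of the
    residue. *)
Fixpoint conv_pow (m : nat) (a : int) : R :=
  if m is m'.+1 then \sum_(b < N) pr b * conv_pow m' (a - b%:Z)
  else (N%:Z %| a)%Z%:R.

(** Probability of a hit during the [M] steps after time [n], from position [x] at time [n].
    Conditioning on one step is built in, so that it can be compared with [visits] by induction. *)
Fixpoint hit_rec (M n : nat) (x : int) : R :=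
  if M is M'.+1 then
    \sum_(b < N) pr b * (if (N%:Z %| x + b%:Z - y n.+1)%Z then 1
                         else hit_rec M' n.+1 (x + b%:Z))
  else 0.

Definition visits (M n : nat) (x : int) : R :=
  \sum_(m < M) conv_pow m.+1 (y (n + m.+1)%N - x).

Lemma conv_pow_ge0 m a : 0 <= conv_pow m a.
Proof.
elim: m a => [|m IH] a /=; first by case: (_ %| _)%Z.
by apply: sumr_ge0 => b _; rewrite mulr_ge0.
Qed.

Lemma conv_pow_mod m a a' : (N%:Z %| a - a')%Z -> conv_pow m a = conv_pow m a'.
Proof.
elim: m a a' => [|m IH] a a' H /=.
  by rewrite -{1}(subrK a' a) rpredDl.
by apply: eq_bigr => b _; congr (_ * _); apply: IH; rewrite opprB addrA subrK.
Qed.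

Lemma visitsS M n x : visits M.+1 n x =
  \sum_(b < N) pr b * ((N%:Z %| x + b%:Z - y n.+1)%Z%:R + visits M n.+1 (x + b%:Z)).
Proof.
rewrite /visits big_ord_recl.
under [RHS]eq_bigr do rewrite mulrDr mulr_sumr.
rewrite big_split /= exchange_big /=; congr (_ + _).
  apply: eq_bigr => b _; congr (_ * _).
  by rewrite addn1 (_ : _ - x - _ = - (x + b%:Z - y n.+1)) ?rpredN //; ring.
apply: eq_bigr => m _; apply: eq_bigr => b _; congr (_ * _).
rewrite /bump leq0n add1n addSnnS opprD addrA //.
Qed.

Lemma visits_mod M n x x' : (N%:Z %| x - x')%Z -> visits M n x = visits M n x'.
Proof.
move=> H; apply: eq_bigr => m _; apply: conv_pow_mod.
by rewrite (_ : _ - _ = - (x - x')) ?rpredN //; ring.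
Qed.

Lemma visits_mono M M' n x : (M <= M')%N -> visits M n x <= visits M' n x.
Proof.
move=> le; rewrite /visits -!(big_mkord xpredT (fun m => conv_pow m.+1 (y (n + m.+1)%N - x))).
rewrite [leRHS](big_cat_nat (leq0n M) le) /= lerDl sumr_ge0 // => i _; exact: (conv_pow_ge0 i.+1).
Qed.

(** Before the first hit there is nothing to count; at the first hit, the hit and all later visits
    together cost at most [K]. *)
Lemma visits_le_hit (K : R) L : 0 <= K ->
  (forall n M, (M <= L)%N -> 1 + visits M n.+1 (y n.+1) <= K) ->
  forall M n x, (M <= L)%N -> visits M n x <= K * hit_rec M n x.
Proof.
move=> K0 HK; elim=> [|M IH] n x ML; first by rewrite /visits big_ord0 mulr0.
rewrite visitsS /= mulr_sumr; apply: ler_sum => b _.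
rewrite mulrCA ler_wpM2l //; case: ifP => [D|_]; last by rewrite add0r IH // ltnW.
by rewrite mulr1 (visits_mod _ _ D) HK // ltnW.
Qed.

(** A hit at the very end of the [M] steps still needs [L] further steps to collect its [k] expected
    visits, hence the horizon [M + L]. *)
Lemma hit_le_visits (k : R) L :
  (forall n, k <= 1 + visits L n.+1 (y n.+1)) ->
  forall M n x, k * hit_rec M n x <= visits (M + L) n x.
Proof.
move=> Hk; elim=> [|M IH] n x.
  by rewrite mulr0 sumr_ge0 // => i _; exact: (conv_pow_ge0 i.+1).
rewrite addSn visitsS /= mulr_sumr; apply: ler_sum => b _.
rewrite mulrCA ler_wpM2l //; case: ifP => [D|_]; last by rewrite add0r.
rewrite mulr1 (visits_mod _ _ D); apply: le_trans (Hk n) _.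
by rewrite lerD2l visits_mono // leq_addl.
Qed.

Lemma sum_dvd_residue (a : int) : \sum_(x < N) (N%:Z %| a - x%:Z)%Z%:R = 1 :> R.
Proof.
have Nz : N%:Z != 0 by case: N N0.
have ge := modz_ge0 a Nz.
have lt : (`|(a %% N)%Z| < N)%N.
  by have := ltz_pmod a (d := N%:Z); rewrite -ltz_nat gez0_abs //; apply.
rewrite (bigD1 (Ordinal lt)) //= big1 ?addr0.
  by rewrite gez0_abs // -eqz_mod_dvd modz_mod eqxx.
move=> i ne; rewrite -eqz_mod_dvd; case: eqP => // E; case/eqP: ne.
apply: val_inj => /=; rewrite E modz_small ?absz_nat //.
by rewrite lez_nat ltz_nat ltn_ord.
Qed.

(** Invariance of the uniform law, written as a sum over starting residues. *)
Lemma sum_conv_pow m a : \sum_(x < N) conv_pow m (a - x%:Z) = 1.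
Proof.
elim: m a => [|m IH] a /=; first exact: sum_dvd_residue.
rewrite exchange_big /= -pr_sum1; apply: eq_bigr => b _.
rewrite -mulr_sumr -[RHS]mulr1; congr (_ * _); rewrite -(IH (a - b%:Z)).
by apply: eq_bigr => x _; rewrite addrAC.
Qed.

Lemma sum_visits M n : \sum_(x < N) visits M n x%:Z = M%:R.
Proof.
rewrite /visits exchange_big (eq_bigr (fun=> 1)) => [|m _].
  by rewrite sumr_const card_ord.
exact: (sum_conv_pow m.+1).
Qed.

Lemma mean_hit_ge (K : R) : 0 < K ->
  (forall n M, (M <= N)%N -> 1 + visits M n.+1 (y n.+1) <= K) ->
  K^-1 <= N%:R^-1 * \sum_(x < N) hit_rec N 0 x%:Z.
Proof.
move=> K0 HK; rewrite -[X in X <= _]mul1r ler_pdivrMr //.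
have NR : 0 < N%:R :> R by rewrite ltr0n.
rewrite -mulrA ler_pdivlMl // mulr1 -(sum_visits N 0) mulr_suml.
by apply: ler_sum => x _; rewrite mulrC; apply: (visits_le_hit (ltW K0) HK).
Qed.

Lemma mean_hit_le (k : R) : 0 < k ->
  (forall n, k <= 1 + visits N n.+1 (y n.+1)) ->
  N%:R^-1 * \sum_(x < N) hit_rec N 0 x%:Z <= 2 / k.
Proof.
move=> k0 Hk; have NR : 0 < N%:R :> R by rewrite ltr0n.
rewrite ler_pdivlMr // -mulrA ler_pdivrMl // mulr_suml.
apply: (@le_trans _ _ (\sum_(x < N) visits (N + N) 0 x%:Z)).
  by apply: ler_sum => x _; rewrite mulrC; exact: hit_le_visits.
by rewrite sum_visits natrD; lra.
Qed.

End ResidueWalk.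

(** Allows the path to be redefined after the last time that counts. *)
Lemma hit_rec_eq (R : realType) (N : nat) (pr : nat -> R) (y y' : nat -> int) M n x :
  (forall i, (n < i <= n + M)%N -> y i = y' i) ->
  hit_rec N pr y M n x = hit_rec N pr y' M n x.
Proof.
elim: M n x => [//|M IH] n x H /=; apply: eq_bigr => b _; congr (_ * _).
rewrite H; last lia.
by case: ifP => // _; apply: IH => i Hi; apply: H; lia.
Qed.

(** * Fourier analysis on Z/N *)

Section RootsOfUnity.
Variable R : realType.
Implicit Types (x al r : R) (k a : int) (N j : nat).

Definition angle N j : R := 2 * pi * j%:R / N%:R.

Lemma cosD2piz x k : cos (x + 2 * pi * k%:~R) = cos x.
Proof.
have H n z : cos (z + 2 * pi * n%:R) = cos z :> R.
  by rewrite -(periodicn (@cosD2pi R) n z); congr (cos (_ + _)); rewrite -mulrnA -(mulr_natr (pi : R)) natrM; ring.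
case: k => n; first exact: H.
by rewrite NegzE -(H n.+1); congr cos; rewrite mulrNz -pmulrn; ring.
Qed.

Lemma sinD2piz x k : sin (x + 2 * pi * k%:~R) = sin x.
Proof.
have H n z : sin (z + 2 * pi * n%:R) = sin z :> R.
  by rewrite -(periodicn (@sinD2pi R) n z); congr (sin (_ + _)); rewrite -mulrnA -(mulr_natr (pi : R)) natrM; ring.
case: k => n; first exact: H.
by rewrite NegzE -(H n.+1); congr sin; rewrite mulrNz -pmulrn; ring.
Qed.

Lemma angle_mod N j a a' : (0 < N)%N -> (N%:Z %| a - a')%Z ->
  exists k, angle N j * a%:~R = angle N j * a'%:~R + 2 * pi * k%:~R.
Proof.
move=> N0 /dvdzP[q E]; exists (q * j%:Z).
have -> : a = q * N%:Z + a' by rewrite -E subrK.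
rewrite /angle !(intrD, intrM) -!pmulrn; field.
by rewrite pnatr_eq0 -lt0n.
Qed.

Lemma cos_angle_mod N j a a' : (0 < N)%N -> (N%:Z %| a - a')%Z ->
  cos (angle N j * a%:~R) = cos (angle N j * a'%:~R).
Proof. by move=> N0 /(angle_mod j N0)[k ->]; rewrite cosD2piz. Qed.

Lemma sin_angle_mod N j a a' : (0 < N)%N -> (N%:Z %| a - a')%Z ->
  sin (angle N j * a%:~R) = sin (angle N j * a'%:~R).
Proof. by move=> N0 /(angle_mod j N0)[k ->]; rewrite sinD2piz. Qed.

Lemma cos_angle_sub N j a : (0 < N)%N -> (j <= N)%N ->
  cos (angle N (N - j) * a%:~R) = cos (angle N j * a%:~R).
Proof.
move=> N0 jN; rewrite -[RHS]cosN -[RHS](cosD2piz _ a); congr cos.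
by rewrite /angle natrB //; field; rewrite pnatr_eq0 -lt0n.
Qed.

(** Multiplying by [2 sin (x / 2)] telescopes the sum. After reducing [a] to its residue [b], a
    nonzero [b] gives [0 < x / 2 < pi], so this factor can be cancelled. *)
Lemma sum_cos_angle N a : (0 < N)%N ->
  \sum_(j < N) cos (angle N j * a%:~R) = N%:R * (N%:Z %| a)%Z%:R.
Proof.
move=> N0; have NR : 0 < N%:R :> R by rewrite ltr0n.
have Nz : N%:Z != 0 by case: N N0 {NR}.
pose b := (a %% N%:Z)%Z.
have dab : (N%:Z %| a - b)%Z by rewrite -eqz_mod_dvd modz_mod.
have -> : (N%:Z %| a)%Z = (b == 0) by apply/dvdz_mod0P/eqP.
rewrite (eq_bigr (fun j : 'I_N => cos (angle N j * b%:~R))) => [|j _]; last first.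
  exact: cos_angle_mod.
have [->|bn] := eqVneq b 0.
  under eq_bigr do rewrite mulr0 cos0.
  by rewrite sumr_const card_ord mulr1.
rewrite mulr0.
have bgt : 0 < b by rewrite lt_neqAle eq_sym bn modz_ge0.
have blt : b < N%:Z by rewrite ltz_pmod.
pose x : R := 2 * pi * b%:~R / N%:R.
have sx : 0 < sin (x / 2).
  have -> : x / 2 = pi * (b%:~R / N%:R) by rewrite /x; field; rewrite gt_eqF.
  apply: sin_gt0_pi; rewrite mulr_gt0 ?pi_gt0 ?divr_gt0 ?ltr0z //=.
  by rewrite gtr_pMr ?pi_gt0 // ltr_pdivrMr // mul1r -[N%:R]/(N%:Z%:~R) ltr_int.
apply: (mulfI (lt0r_neq0 (mulr_gt0 (ltr0n _ 2) sx))); rewrite mulr0 mulr_sumr.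
pose f n := sin ((n%:R - 2^-1) * x).
rewrite (eq_bigr (fun j : 'I_N => f j.+1 - f j)) => [|j _]; last first.
  rewrite /f (_ : angle N j * _ = j%:R * x); last by rewrite /angle /x; ring.
  have -> : (j.+1%:R - 2^-1) * x = j%:R * x + x / 2 by rewrite -natr1; field.
  have -> : (j%:R - 2^-1) * x = j%:R * x - x / 2 by field.
  by rewrite sinD sinB; ring.
rewrite -(big_mkord xpredT (fun j => f j.+1 - f j)) telescope_sumr // /f.
have -> : (N%:R - 2^-1) * x = - (x / 2) + 2 * pi * b%:~R.
  by rewrite /x; field; rewrite gt_eqF.
by rewrite sinD2piz sub0r mulNr mulrC subrr.
Qed.

(** A geometric sum in real form: with [z = r e^(i al)], the hypotheses say [z^N = r^N], the first
    factor is [|1 - z|^2], and adding the reflected powers leaves the numerator [1 - r^2] of the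
    Poisson kernel. *)
Lemma poisson_sum N (r al : R) : cos (N%:R * al) = 1 -> sin (N%:R * al) = 0 ->
  (1 - 2 * r * cos al + r ^+ 2) *
    (\sum_(j < N) (r ^+ j + r ^+ (N - j)) * cos (j%:R * al)) =
  (1 - r ^+ N) * (1 - r ^+ 2).
Proof.
move=> cN sN; set D := 1 - _ + _.
have cperm n : (n <= N)%N -> cos ((N - n)%:R * al) = cos (n%:R * al).
  by move=> nN; rewrite natrB // mulrBl cosB cN sN; ring.
pose A := \sum_(j < N) r ^+ j * cos (j%:R * al).
have DA : D * A = (1 - r ^+ N) * (1 - r * cos al).
  (* [f n] is minus the real part of [z^n (1 - r e^(- i al))]; it telescopes because [D] is the
     product of [1 - z] and [1 - r e^(- i al)]. *)
  pose f n := - (r ^+ n * cos (n%:R * al) - r ^+ n.+1 * cos (n%:R * al - al)).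
  rewrite mulr_sumr (eq_bigr (fun j : 'I_N => f j.+1 - f j)) => [|j _]; last first.
    have -> : f j.+1 - f j = r ^+ j * cos (j%:R * al) + r ^+ j.+2 * cos (j%:R * al)
       - r ^+ j.+1 * (cos (j%:R * al + al) + cos (j%:R * al - al)).
      rewrite /f -natr1 mulrDl mul1r addrK; ring.
    by rewrite cosD cosB /D !exprS; ring.
  rewrite -(big_mkord xpredT (fun j => f j.+1 - f j)) telescope_sumr // /f.
  rewrite mul0r cos0 sub0r cosN cosB cN sN !exprS expr0; ring.
(* The reflected exponents run over [1 .. N] instead of [0 .. N - 1]: the term [1] is lost and
   [r ^+ N] gained. *)
have rev : \sum_(j < N) r ^+ (N - j) * cos (j%:R * al) = A - 1 + r ^+ N.
  rewrite (reindex_inj rev_ord_inj) /=.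
  rewrite (eq_bigr (fun j : 'I_N => r ^+ j.+1 * cos (j.+1%:R * al))) => [|j _]; last first.
    by rewrite subKn ?cperm.
  have E1 : \sum_(j < N.+1) r ^+ j * cos (j%:R * al) = A + r ^+ N.
    by rewrite big_ord_recr /= cN mulr1.
  have E2 : \sum_(j < N.+1) r ^+ j * cos (j%:R * al) =
      1 + \sum_(j < N) r ^+ j.+1 * cos (j.+1%:R * al).
    by rewrite big_ord_recl expr0 mul0r cos0 mulr1.
  by apply: (addrI 1); rewrite -E2 E1; ring.
under eq_bigr do rewrite mulrDl.
rewrite big_split /= rev -/A.
have -> : D * (A + (A - 1 + r ^+ N)) = 2 * (D * A) - D * (1 - r ^+ N) by ring.
by rewrite DA /D; ring.
Qed.

End RootsOfUnity.

(** * Fourier inversion for convolution powers *)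

Section Fourier.
Variables (R : realType) (N : nat) (pr : nat -> R).
Hypothesis N0 : (0 < N)%N.
Hypothesis pr_sin : forall j, \sum_(b < N) pr b * sin (angle R N j * (b%:Z)%:~R) = 0.

Definition dft (j : nat) : R := \sum_(b < N) pr b * cos (angle R N j * (b%:Z)%:~R).

Lemma dft_sub j : (j <= N)%N -> dft (N - j) = dft j.
Proof. by move=> jN; apply: eq_bigr => b _; rewrite cos_angle_sub. Qed.

(** Each convolution multiplies frequency [j] by its transform; the sine half of the addition
    formula drops out because the transform is real. *)
Lemma conv_pow_dft m a : conv_pow N pr m a =
  N%:R^-1 * \sum_(j < N) dft j ^+ m * cos (angle R N j * a%:~R).
Proof.
have NR : 0 < N%:R :> R by rewrite ltr0n.
elim: m a => [|m IH] a /=.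
  under eq_bigr do rewrite expr0 mul1r.
  by rewrite sum_cos_angle // mulKf // gt_eqF.
under eq_bigr do rewrite IH mulrCA mulr_sumr.
rewrite -mulr_sumr exchange_big /=; congr (_ * _).
apply: eq_bigr => j _; rewrite exprSr -mulrA.
under eq_bigr do rewrite mulrCA; rewrite -mulr_sumr; congr (_ * _).
under eq_bigr do rewrite intrB mulrBr cosB mulrDr.
rewrite big_split /= [X in _ + X](_ : _ = 0) ?addr0.
  rewrite /dft mulr_suml.
  by apply: eq_bigr => b _; ring.
transitivity (sin (angle R N j * a%:~R) * \sum_(b < N) pr b * sin (angle R N j * (b%:Z)%:~R)).
  by rewrite mulr_sumr; apply: eq_bigr => b _; ring.
by rewrite pr_sin mulr0.
Qed.

End Fourier.

(** * Hitting event *)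

Section HittingEvent.
Variables (d : measure_display) (T : measurableType d) (R : realType).
Variables (P : probability T R) (X : nat -> T -> int).
Variables (N : nat) (y : nat -> int).
Hypothesis N0 : (0 < N)%N.
Hypothesis Xm : iid_discrete_rvs X.
Hypothesis Xid : iid_ident_distr P X.
Hypothesis Xind : iid_mutually_indep P X.

Definition residue_class (b : nat) : set int := [set k | (N%:Z %| k - b%:Z)%Z].

Definition residue_law (b : nat) : R := fine (P (X 1 @^-1` residue_class b)).

Lemma fineP (A : set T) : measurable A -> ((fine (P A))%:E = P A)%E.
Proof. by move=> mA; rewrite fineK // fin_num_measure. Qed.

Lemma residue_class_cover k : exists2 b : 'I_N, residue_class b k &
  forall b' : 'I_N, residue_class b' k -> b' = b.
Proof.
have Nz : N%:Z != 0 by case: N N0.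
have ge := modz_ge0 k Nz.
have lt : (`|(k %% N)%Z| < N)%N.
  by have := ltz_pmod k (d := N%:Z); rewrite -ltz_nat gez0_abs //; apply.
exists (Ordinal lt) => [|b']; rewrite /residue_class /= -eqz_mod_dvd.
  by rewrite gez0_abs // modz_mod.
move/eqP => E; apply: val_inj => /=; rewrite E modz_small ?absz_nat //.
by rewrite lez_nat ltz_nat ltn_ord.
Qed.

Lemma measure_residue_split j (E : set T) : (0 < j)%N -> measurable E ->
  (P E = \sum_(b < N) P (E `&` X j @^-1` residue_class b))%E.
Proof.
move=> j0 mE; rewrite -(measure_bigsetU_ord P xpredT) //.
- congr (P _); apply/seteqP; split => w.
    move=> Ew; have [b bw _] := residue_class_cover (X j w).
    rewrite -(bigcup_mkord N (fun b => E `&` X j @^-1` residue_class b)).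
    by exists b => //=.
  by rewrite -(bigcup_mkord N (fun b => E `&` X j @^-1` residue_class b)) => -[b _ []].
- by move=> b; apply: measurableI => //; exact: Xm.
- move=> a b _ _ [w [[_ aw] [_ bw]]].
  by have [c _ H] := residue_class_cover (X j w); rewrite (H a aw) (H b bw).
Qed.

(** The event behind [hit_rec], with the same recursion followed along a sample path. *)
Fixpoint hit_set (M n : nat) (x : int) : set T :=
  if M is M'.+1 then
    [set w | (N%:Z %| x + X n.+1 w - y n.+1)%Z \/
             hit_set M' n.+1 (x + X n.+1 w) w]
  else set0.

Lemma hit_set_mod M n x x' : (N%:Z %| x - x')%Z ->
  hit_set M n x = hit_set M n x'.
Proof.
elim: M n x x' => [//|M IH] n x x' D; apply/funext => w /=.
rewrite (IH _ _ (x' + X n.+1 w)); last by rewrite opprD addrACA subrr addr0.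
rewrite (_ : (N%:Z %| x + X n.+1 w - y n.+1)%Z = (N%:Z %| x' + X n.+1 w - y n.+1)%Z) //.
have -> : x + X n.+1 w - y n.+1 = (x - x') + (x' + X n.+1 w - y n.+1) by ring.
by rewrite rpredDl.
Qed.

Lemma hit_setS M n x b w : residue_class b (X n.+1 w) ->
  hit_set M.+1 n x w <->
  (if (N%:Z %| x + b%:Z - y n.+1)%Z then setT else hit_set M n.+1 (x + b%:Z)) w.
Proof.
rewrite /residue_class /= => D.
have /= -> : hit_set M n.+1 (x + X n.+1 w) = hit_set M n.+1 (x + b%:Z).
  by apply: hit_set_mod; rewrite opprD addrACA subrr add0r.
have -> : x + X n.+1 w - y n.+1 = (X n.+1 w - b%:Z) + (x + b%:Z - y n.+1) by ring.
by rewrite rpredDl //; case: ifP => _; split => //; [left|case|right].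
Qed.

Lemma measurable_hit_set M n x : measurable (hit_set M n x).
Proof.
elim: M n x => [|M IH] n x; first exact: measurable0.
have -> : hit_set M.+1 n x = \big[setU/set0]_(b < N) (X n.+1 @^-1` residue_class b `&`
    (if (N%:Z %| x + b%:Z - y n.+1)%Z then setT else hit_set M n.+1 (x + b%:Z))).
  rewrite -(bigcup_mkord N (fun b => X n.+1 @^-1` residue_class b `&`
    (if (N%:Z %| x + b%:Z - y n.+1)%Z then setT else hit_set M n.+1 (x + b%:Z)))).
  apply/seteqP; split => w.
    move=> Hw; have [b bw _] := residue_class_cover (X n.+1 w).
    exists b; first exact: ltn_ord.
    by split => //; apply/hit_setS.
  by move=> [b _ [bw Hw]]; apply/(hit_setS _ _ bw).
apply: bigsetU_measurable => b _; apply: measurableI; first exact: Xm.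
by case: ifP.
Qed.

Definition cylinder n (B : nat -> set int) : set T :=
  \big[setI/setT]_(j <- iota 1 n) (X j @^-1` B j).

Lemma iota1S n : iota 1 n.+1 = iota 1 n ++ [:: n.+1].
Proof. by rewrite -[in LHS](addn1 n) iotaD add1n. Qed.

Lemma cylinderS n B A : cylinder n B `&` X n.+1 @^-1` A =
  cylinder n.+1 (fun j => if j == n.+1 then A else B j).
Proof.
rewrite /cylinder iota1S big_cat big_seq1 eqxx.
congr (_ `&` _); rewrite !big_seq; apply: eq_bigr => j.
by rewrite mem_iota => Hj; rewrite (_ : j == n.+1 = false) //; apply/eqP; lia.
Qed.

Lemma measurable_cylinder n B : measurable (cylinder n B).
Proof.
rewrite /cylinder big_seq; apply: bigsetI_measurable => j.
by rewrite mem_iota => Hj; apply: Xm; lia.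
Qed.

Lemma measure_cylinder n B :
  (P (cylinder n B) = \prod_(j <- iota 1 n) P (X j @^-1` B j))%E.
Proof. by apply: Xind; [exact: iota_uniq|apply/allP => j; rewrite mem_iota; lia]. Qed.

Lemma measure_cylinderS n B b :
  P (cylinder n B `&` X n.+1 @^-1` residue_class b) =
  (P (cylinder n B) * (residue_law b)%:E)%E.
Proof.
rewrite cylinderS !measure_cylinder iota1S big_cat big_seq1 eqxx.
congr (_ * _)%E; last by rewrite fineP ?Xid //; apply: Xm.
rewrite !big_seq; apply: eq_bigr => j.
by rewrite mem_iota => Hj; rewrite (_ : j == n.+1 = false) //; apply/eqP; lia.
Qed.

(** The induction ranges over all cylinders: splitting on the residue of step [n + 1] replaces the
    random position by [x + b] and lengthens the cylinder by one step. Independence is then needed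
    only for finite products. *)
Lemma measure_cylinder_hit M n x B :
  P (cylinder n B `&` hit_set M n x) =
  (P (cylinder n B) * (hit_rec N residue_law y M n x)%:E)%E.
Proof.
elim: M n x B => [|M IH] n x B; first by rewrite /= setI0 measure0 mule0.
rewrite (measure_residue_split (j := n.+1)) //; last first.
  by apply: measurableI; [exact: measurable_cylinder|exact: measurable_hit_set].
have := fineP (measurable_cylinder n B).
set c := fine _ => Ec.
rewrite [hit_rec _ _ _ _ _ _]/= -Ec -EFinM mulr_sumr -sumEFin; apply: eq_bigr => b _.
rewrite mulrA EFinM [in RHS]EFinM Ec -measure_cylinderS.
set D := cylinder n B `&` X n.+1 @^-1` residue_class b.
have -> : cylinder n B `&` hit_set M.+1 n x `&` X n.+1 @^-1` residue_class b = D `&`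
   (if (N%:Z %| x + b%:Z - y n.+1)%Z then setT else hit_set M n.+1 (x + b%:Z)).
  apply/seteqP; split => w [[H1 H2] H3]; first by split => //; apply/(hit_setS M x H3).
  by split => //; split => //; apply/(hit_setS M x H2).
case: ifP => _; first by rewrite setIT mule1.
by rewrite /D cylinderS IH.
Qed.

Lemma hit_setP M n x w : hit_set M n x w <-> exists m : nat,
  [/\ (1 <= m)%N, (m <= M)%N &
   (N%:Z %| x + \sum_(n.+1 <= j < (n + m).+1) X j w - y (n + m)%N)%Z].
Proof.
elim: M n x => [|M IH] n x /=; first by split => // -[m [m1 m0 _]]; lia.
rewrite IH; split => [[D|[m [m1 mM D]]]|[[|m] [// _ mM D]]].
- by exists 1%N; rewrite addn1 big_nat1.
- exists m.+1; split => //; rewrite big_ltn; last lia.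
  by rewrite -addSnnS addrA.
- move: D; rewrite -addSnnS big_ltn; last lia.
  case: m mM => [|m] mM; last by rewrite addrA => D; right; exists m.+1.
  by rewrite addn0 big_geq // addr0; left.
Qed.

Lemma hit_probE :
  hit_prob P X N y = N%:R^-1 * \sum_(x < N) hit_rec N residue_law y N 0 x%:Z.
Proof.
congr (_ * _); apply: eq_bigr => x _.
transitivity (fine (P (hit_set N 0 x%:Z))).
  congr (fine (P _)); apply/seteqP; split => w /=.
    move=> [n [n1 nN /eqP H]]; apply/hit_setP; exists n; split => //.
    by rewrite -eqz_mod_dvd.
  move=> /hit_setP[n [n1 nN]]; rewrite -eqz_mod_dvd => /eqP H.
  by exists n.
have := measure_cylinder_hit N 0 x%:Z (fun=> setT).
by rewrite /cylinder big_nil setTI probability_setT mul1e => ->.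
Qed.

Lemma residue_law_ge0 b : 0 <= residue_law b.
Proof. by rewrite /residue_law fine_ge0. Qed.

Lemma sum_residue_law : \sum_(b < N) residue_law b = 1.
Proof.
apply: EFin_inj; rewrite -sumEFin -(@probability_setT _ _ _ P).
rewrite (measure_residue_split (j := 1)) //; apply: eq_bigr => b _.
by rewrite setTI fineP //; exact: Xm.
Qed.

End HittingEvent.

(** * Characteristic function *)

Section CharacteristicFunction.
Variable R : realType.
Implicit Types (f g : int -> R) (n : nat) (k : int) (th : R).

Definition sym_psum f n : R := \sum_(i < n.*2.+1) f (i%:Z - n%:Z).

Lemma sym_psumS f n :
  sym_psum f n.+1 = f (- n.+1%:Z) + sym_psum f n + f n.+1%:Z.
Proof.
rewrite /sym_psum doubleS big_ord_recr big_ord_recl /= sub0r.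
congr (_ + _ + f _); last by rewrite -addnn; lia.
by apply: eq_bigr => i _; congr f; rewrite /bump; lia.
Qed.

Lemma sym_psum_ge f n k : (forall i, 0 <= f i) -> `|k| <= n%:Z -> f k <= sym_psum f n.
Proof.
move=> f0 kn; pose j := absz (k + n%:Z).
have lt : (j < n.*2.+1)%N by rewrite /j; lia.
rewrite /sym_psum (bigD1 (Ordinal lt)) //= (_ : j%:Z - n%:Z = k); last by rewrite /j; lia.
by rewrite lerDl sumr_ge0.
Qed.

Lemma sym_psum_homo f : (forall i, 0 <= f i) ->
  {homo sym_psum f : m n / (m <= n)%N >-> m <= n}.
Proof.
move=> f0; apply/nondecreasing_seqP => n; rewrite sym_psumS.
by rewrite addrAC lerDr addr_ge0.
Qed.

Lemma sym_psum_odd f n : (forall k, f (- k) = - f k) -> sym_psum f n = 0.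
Proof.
move=> fN; have f0 : f 0 = 0 by have := fN 0; rewrite oppr0; lra.
elim: n => [|n IH]; first by rewrite /sym_psum big_ord1 subrr.
by rewrite sym_psumS IH fN addr0 addNr.
Qed.

Variable p : int -> R.
Hypothesis p_ge0 : forall k, 0 <= p k.
Hypothesis p_cvg1 : sym_psum p n @[n --> \oo] --> (1 : R).

Lemma sym_psum_le1 n : sym_psum p n <= 1.
Proof.
have /(cvg_lim (@Rhausdorff R)) <- := p_cvg1.
by apply: nondecreasing_cvgn_le; [exact: sym_psum_homo|apply/cvg_ex; exists 1].
Qed.

Let cosp th k := p k * cos (th * k%:~R).

(** Adding [1] to the cosine makes the terms nonnegative, so the partial sums increase and stay
    below 2; the convergent sum of [p] is then subtracted. *)
Lemma phi_re_cvg th : cvgn (sym_psum (cosp th)).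
Proof.
pose g k := p k * (1 + cos (th * k%:~R)).
have g0 k : 0 <= g k by rewrite mulr_ge0 // addrC -ler_subl_addr sub0r cos_geN1.
have -> : sym_psum (cosp th) = sym_psum g - sym_psum p.
  apply/funext => n; rewrite !fctE /sym_psum -sumrB.
  by apply: eq_bigr => i _; rewrite /g /cosp; ring.
apply: is_cvgB; last by apply/cvg_ex; exists 1.
apply: nondecreasing_is_cvgn; first exact: sym_psum_homo.
exists 2 => _ [n _ <-]; have := sym_psum_le1 n.
suff : sym_psum g n <= 2 * sym_psum p n by lra.
rewrite /sym_psum mulr_sumr; apply: ler_sum => i _.
rewrite /g mulrC ler_wpM2r //; have := cos_le1 (th * (i%:Z - n%:Z)%:~R); lra.
Qed.

(** In the nonnegative series of [p (1 - cos)], whose sum is [1 - phi], a single term is kept. *)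
Lemma phi_re_le th k : phi_re p th <= 1 - p k * (1 - cos (th * k%:~R)).
Proof.
apply: limr_le; first exact: phi_re_cvg.
exists `|k|%N => // n; rewrite /mkset => kn.
pose g k := p k * (1 - cos (th * k%:~R)).
have g0 i : 0 <= g i by rewrite mulr_ge0 // subr_ge0 cos_le1.
have gk : g k <= sym_psum g n by apply: sym_psum_ge => //; lia.
suff E : sym_psum (cosp th) n = sym_psum p n - sym_psum g n.
  by rewrite -/(g k) -[leLHS]/(sym_psum (cosp th) n) E; have := sym_psum_le1 n; lra.
by rewrite /sym_psum -sumrB; apply: eq_bigr => i _; rewrite /g /cosp; ring.
Qed.

Lemma phi_re_ge th k : p k * (1 + cos (th * k%:~R)) - 1 <= phi_re p th.
Proof.
apply: limr_ge; first exact: phi_re_cvg.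
exists `|k|%N => // n; rewrite /mkset => kn.
pose g k := p k * (1 + cos (th * k%:~R)).
have g0 i : 0 <= g i by rewrite mulr_ge0 //; have := cos_geN1 (th * i%:~R); lra.
have gk : g k <= sym_psum g n by apply: sym_psum_ge => //; lia.
suff E : sym_psum (cosp th) n = sym_psum g n - sym_psum p n.
  by rewrite -/(g k) -[leRHS]/(sym_psum (cosp th) n) E; have := sym_psum_le1 n; lra.
by rewrite /sym_psum -sumrB; apply: eq_bigr => i _; rewrite /g /cosp; ring.
Qed.

Lemma law_support : exists k, 0 < p k.
Proof.
apply: contrapT => /forallNP H.
suff E : sym_psum p = fun=> 0.
  have := p_cvg1; rewrite E => /(cvg_lim (@Rhausdorff R)).
  by rewrite lim_cst // => /eqP; rewrite eq_sym oner_eq0.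
apply/funext => n; apply: big1 => i _; apply/eqP.
by rewrite eq_le p_ge0 andbT leNgt; apply/negP/H.
Qed.

Hypothesis p_aper : strongly_aperiodic p.

Lemma sin_eq0_of_cos (x : R) : cos x ^+ 2 = 1 -> sin x = 0.
Proof.
move=> H; have := cos2Dsin2 x; rewrite H => E.
by apply/eqP; rewrite -sqrf_eq0; apply/eqP; lra.
Qed.

Lemma subgroup_cos1 th : subgroupZ [set k | cos (th * k%:~R) = 1 :> R].
Proof.
have s0 k : cos (th * k%:~R) = 1 :> R -> sin (th * k%:~R) = 0.
  by move=> H; apply: sin_eq0_of_cos; rewrite H expr1n.
split => [|a b Ha Hb] /=; first by rewrite mulr0 cos0.
by rewrite intrB mulrBr cosB Ha Hb (s0 _ Ha) (s0 _ Hb); ring.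
Qed.

(** The kernel of the character [k |-> e^(i th k)] is a subgroup containing the shifted support,
    hence all of Z. Then [cos th = 1], impossible on [(0, pi]]. *)
Lemma cos_eq1_absurd th y : 0 < th <= pi ->
  (forall k, 0 < p k -> cos (th * (y + k)%:~R) = 1 :> R) -> False.
Proof.
move=> /andP[th0 thpi] H.
have := p_aper (subgroup_cos1 th) H => E.
have : [set k | cos (th * k%:~R) = 1 :> R] 1 by rewrite E.
rewrite /= mulr1 => c1; suff E0 : th = 0 by rewrite E0 ltxx in th0.
by apply: cos_inj; rewrite ?in_itv /= ?lexx ?pi_ge0 ?thpi ?(ltW th0) ?cos0.
Qed.

Lemma exists_cos_lt1 th : 0 < th <= pi -> exists2 k, 0 < p k & cos (th * k%:~R) < 1.
Proof.
move=> Hth; apply: contrapT => H; apply: (cos_eq1_absurd (y := 0) Hth) => k pk.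
rewrite add0r; apply/eqP; rewrite eq_le cos_le1 leNgt; apply/negP => lt.
by apply: H; exists k.
Qed.

(** The shift in strong aperiodicity rules out [phi = -1]: if the cosine were [-1] on the whole
    support, translating the support by [- k0] for an atom [k0] would make it [1] there. *)
Lemma exists_cos_gtN1 th : 0 < th <= pi -> exists2 k, 0 < p k & -1 < cos (th * k%:~R).
Proof.
move=> Hth; apply: contrapT => H.
have cN k : 0 < p k -> cos (th * k%:~R) = - 1.
  move=> pk; apply/eqP; rewrite eq_le cos_geN1 andbT leNgt; apply/negP => lt.
  by apply: H; exists k.
have sN k : 0 < p k -> sin (th * k%:~R) = 0.
  by move=> /cN Hk; apply: sin_eq0_of_cos; rewrite Hk sqrrN expr1n.
have [k0 pk0] := law_support.
apply: (cos_eq1_absurd (y := - k0) Hth) => k pk.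
by rewrite addrC intrB mulrBr cosB !cN // !sN //; ring.
Qed.

(** Compactness of [[delta, pi]]: near each angle, one atom keeps [phi] away from [1] and another
    keeps it away from [-1], so continuity of the cosine alone suffices. *)
Lemma phi_re_gap (delta : R) : 0 < delta ->
  exists2 g : R, 0 < g & forall th, delta <= th <= pi -> `|phi_re p th| <= 1 - g.
Proof.
move=> d0.
have /compact_near_coveringP/(_ nat \oo (fun n th => `|phi_re p th| <= 1 - n.+1%:R^-1)) :=
  @segment_compact R delta pi.
case => [th|n _ Hn]; last first.
  exists n.+1%:R^-1; first by rewrite invr_gt0.
  by move=> th Hth; apply: (Hn n) => //=; rewrite in_itv.
rewrite /= in_itv /= => /andP[dth thpi].
have th0 : 0 < th <= pi by rewrite thpi (lt_le_trans d0).
have [k1 pk1 c1] := exists_cos_lt1 th0.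
have [k2 pk2 c2] := exists_cos_gtN1 th0.
(* Half of each atom's deficit at [th]; the other half absorbs the variation of the cosine
   nearby. *)
pose e := Num.min (p k1 * ((1 - cos (th * k1%:~R)) / 2))
                  (p k2 * ((1 + cos (th * k2%:~R)) / 2)).
have e0 : 0 < e.
  by rewrite /e lt_min !mulr_gt0 //; lra.
have cc k : {for th, continuous (fun t : R => cos (t * k%:~R))}.
  apply: continuous_comp; last exact: continuous_cos.
  by apply: cvgMr_tmp; exact: cvg_id.
near=> t n => /=.
have t1 : cos (t * k1%:~R) <= (1 + cos (th * k1%:~R)) / 2.
  by apply: ltW; near: t; apply: (cvgr_lt _ (cc k1)); lra.
have t2 : (cos (th * k2%:~R) - 1) / 2 <= cos (t * k2%:~R).
  by apply: ltW; near: t; apply: (cvgr_gt _ (cc k2)); lra.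
have ne : n.+1%:R^-1 < e by near: n; exact: (near_infty_natSinv_lt (PosNum e0)).
rewrite ler_norml; apply/andP; split.
  apply: le_trans (phi_re_ge t k2).
  suff H : e <= p k2 * (1 + cos (t * k2%:~R)). 
    move: ne H; move: (e : R) (p k2 * _ : R) (n.+1%:R^-1 : R) => u v w; lra.
  rewrite /e ge_min; apply/orP; right; rewrite ler_wpM2l //; lra.
apply: le_trans (phi_re_le t k1) _.
suff H : e <= p k1 * (1 - cos (t * k1%:~R)).
  move: ne H; move: (e : R) (p k1 * _ : R) (n.+1%:R^-1 : R) => u v w; lra.
rewrite /e ge_min; apply/orP; left; rewrite ler_wpM2l //; lra.
Unshelve. all: by end_near.
Qed.

End CharacteristicFunction.

(** * The step law and its reduction modulo N *)

Section StepLaw.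
Variables (d : measure_display) (T : measurableType d) (R : realType).
Variables (P : probability T R) (X : nat -> T -> int).
Hypothesis Xm : iid_discrete_rvs X.
Let p := step_law P X.

Lemma step_law_ge0 k : 0 <= p k.
Proof. by rewrite fine_ge0. Qed.

Lemma sym_psum_step_law (A : set int) n :
  sym_psum (fun k => p k * (k \in A)%:R) n =
  fine (P (X 1 @^-1` (A `&` [set k | `|k| <= n%:Z]))).
Proof.
pose F (i : nat) := X 1 @^-1` (A `&` [set i%:Z - n%:Z]).
have mF i : measurable (F i) by exact: Xm.
have -> : X 1 @^-1` (A `&` [set k | `|k| <= n%:Z]) = \big[setU/set0]_(i < n.*2.+1) F i.
  rewrite -(bigcup_mkord _ F); apply/seteqP; split => w /=.
    move=> [Aw wn]; exists (absz (X 1%N w + n%:Z)); first by rewrite /=; lia.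
    by split => //=; lia.
  move=> [i ilt [Aw /= E]]; split=> //; rewrite /= E; move: ilt; rewrite /=. clear; lia.
rewrite (measure_bigsetU_ord P xpredT (F := fun i : 'I_ _ => F i)) //; last first.
  by move=> i j _ _ [w [[_ /= E1] [_ /= E2]]]; apply: val_inj => /=; lia.
rewrite -sum_fine => [|i _]; last exact: fin_num_measure.
apply: eq_bigr => i _; rewrite /F.
have [iA|iA] := boolP (_ \in A).
  rewrite mulr1; congr (fine (P (_ @^-1` _))); apply/seteqP; split => [k /= ->|k [//]].
  by split => //; exact: set_mem.
rewrite mulr0 (_ : A `&` _ = set0) ?preimage_set0 ?measure0 //.
by apply/seteqP; split => // k [Ak /= E]; case/negP: iA; apply/mem_set; rewrite -E.
Qed.

Lemma cvg_sym_psum_step_law (A : set int) :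
  sym_psum (fun k => p k * (k \in A)%:R) n @[n --> \oo] --> fine (P (X 1 @^-1` A)).
Proof.
rewrite (_ : sym_psum _ =
  fine \o (P \o (fun n : nat => X 1 @^-1` (A `&` [set k | `|k| <= n%:Z])))); last first.
  by apply/funext => n; rewrite sym_psum_step_law.
apply: fine_cvg; rewrite fineK ?fin_num_measure //; last exact: Xm.
have E : X 1 @^-1` A = \bigcup_n X 1 @^-1` (A `&` [set k | `|k| <= n%:Z]).
  apply/seteqP; split => w /=; last by move=> [n _ []].
  by move=> Aw; exists `|X 1 w|%N => //; split => //=; lia.
rewrite E; apply: nondecreasing_cvg_mu.
- by move=> n; exact: Xm.
- by rewrite -E; exact: Xm.
- by move=> m n mn; apply/subsetPset => w [Aw /= H]; split => //=; lia.
Qed.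

Lemma cvg_step_law1 : sym_psum p n @[n --> \oo] --> (1 : R).
Proof.
have := @cvg_sym_psum_step_law setT; rewrite preimage_setT probability_setT /=.
rewrite (_ : sym_psum _ = sym_psum p) //.
by apply/funext => n; apply: eq_bigr => i _; rewrite in_setT mulr1.
Qed.

Lemma cvg_sym_psum_periodic N (f : int -> R) : (0 < N)%N ->
  (forall k (b : nat), residue_class N b k -> f k = f b%:Z) ->
  sym_psum (fun k => p k * f k) n @[n --> \oo] -->
    \sum_(b < N) residue_law P X N b * f b%:Z.
Proof.
move=> N0 fp.
rewrite (_ : sym_psum _ = fun n => \sum_(b < N)
    (sym_psum (fun k => p k * (k \in residue_class N b)%:R) n * f b%:Z)); last first.
  apply/funext => n; under eq_bigr do rewrite mulr_suml.
  rewrite exchange_big; apply: eq_bigr => i _ /=.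
  set k := i%:Z - n%:Z.
  have [b bk ub] := residue_class_cover N0 k.
  rewrite (bigD1 b) //= mem_set // mulr1 (fp _ _ bk) big1 ?addr0 // => b' ne.
  rewrite memNset ?mulr0 ?mul0r // => b'k.
  by move: ne; rewrite (ub _ b'k) eqxx.
apply: cvg_big => [|b _]; first exact: add_continuous.
by apply: cvgMr_tmp; exact: cvg_sym_psum_step_law.
Qed.

(** At multiples of [2 pi / N] the character sees the step only modulo [N], so the identity is
    exact, with no aliasing error. *)
Lemma phi_re_angle N j : (0 < N)%N ->
  phi_re p (angle R N j) = dft N (residue_law P X N) j.
Proof.
move=> N0; apply: (cvg_lim (@Rhausdorff R)).
apply: (cvg_sym_psum_periodic (f := fun k => cos (angle R N j * k%:~R)) N0) => k b.
by move=> H; exact: cos_angle_mod.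
Qed.

Hypothesis p_sym : symmetric_law p.

Lemma residue_law_sin N j : (0 < N)%N ->
  \sum_(b < N) residue_law P X N b * sin (angle R N j * (b%:Z)%:~R) = 0.
Proof.
move=> N0.
have H : sym_psum (fun k => p k * sin (angle R N j * k%:~R)) n @[n --> \oo] -->
    \sum_(b < N) residue_law P X N b * sin (angle R N j * (b%:Z)%:~R).
  apply: (cvg_sym_psum_periodic (f := fun k => sin (angle R N j * k%:~R)) N0) => k b.
  by move=> H; exact: sin_angle_mod.
rewrite -(cvg_lim (@Rhausdorff R) H) (_ : sym_psum _ = fun=> 0) ?lim_cst //.
apply/funext => n; apply: sym_psum_odd => k.
by rewrite -p_sym intrN mulrN sinN mulrN.
Qed.

End StepLaw.

(** * Consequences of (A3) *)

Section SmallAngle.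
Variables (R : realType) (f : R -> R) (beta c eps C0 delta0 : R).
Hypotheses (beta_gt0 : 0 < beta) (c_gt0 : 0 < c) (eps_gt0 : 0 < eps).
Hypotheses (C0_gt0 : 0 < C0) (delta0_gt0 : 0 < delta0).
Hypothesis f_exp : forall th : R, `|th| < delta0 ->
  `|f th - (1 - c * `|th| `^ beta)| <= C0 * `|th| `^ (beta + eps).
Hypothesis f_gap : forall delta : R, 0 < delta ->
  exists2 g : R, 0 < g & forall th : R, delta <= th <= pi -> `|f th| <= 1 - g.

(** Shrinking the exponent keeps the error bound valid for angles at most 1, and puts [e - 1] in
    [(-1, 0)] and [1 + e] below 2, as the later estimates require. *)
Let e := Num.min eps 2^-1.

Lemma min_eps_half_gt0 : 0 < e.
Proof. by rewrite lt_min eps_gt0 invr_gt0 ltr0n. Qed.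

Lemma min_eps_half_lt1 : e < 1.
Proof. by rewrite /e gt_min; apply/orP; right; lra. Qed.

Lemma small_angle : exists delta : R, [/\ 0 < delta, delta <= 1 &
  forall th : R, 0 <= th <= delta ->
  [/\ `|f th - (1 - c * th `^ beta)| <= C0 * th `^ (beta + e),
      th `^ (beta + e) = th `^ beta * th `^ e,
      C0 * th `^ e <= c / 2 & c * th `^ beta <= 1 / 2]].
Proof.
have e0 := min_eps_half_gt0.
have [d1 d10 H1] := powR_small e0 (divr_gt0 c_gt0 (mulr_gt0 C0_gt0 (ltr0n R 2))).
have c2 : 0 < (c * 2)^-1 by rewrite invr_gt0 mulr_gt0.
have [d2 d20 H2] := powR_small beta_gt0 c2.
exists (Num.min (Num.min 1 (delta0 / 2)) (Num.min d1 d2)); split.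
- by rewrite !lt_min ltr01 divr_gt0 //= d10.
- by rewrite !ge_min lexx.
move=> th; rewrite !le_min => /andP[th0 /andP[/andP[th1 thd] /andP[thd1 thd2]]].
have be : beta + e != 0 by rewrite gt_eqF // addr_gt0.
split.
- have thd' : `|th| < delta0.
    by rewrite ger0_norm // (le_lt_trans thd) // ltr_pdivrMr // ltr_pMr // ltr1n.
  have := f_exp thd'; rewrite (ger0_norm th0) => /le_trans; apply.
  rewrite ler_wpM2l ?(ltW C0_gt0) //.
  have [->|tn] := eqVneq th 0; first by rewrite !powR0 // gt_eqF // addr_gt0.
  apply: ger_powR; first by rewrite lt_neqAle eq_sym tn th0.
  by rewrite lerD2l ge_min lexx.
- by rewrite powRD // (negbTE be).
- have := H1 th; rewrite th0 thd1 => /(_ isT) H.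
  have -> : c / 2 = C0 * (c / (C0 * 2)) by field; rewrite gt_eqF.
  by rewrite ler_wpM2l ?(ltW C0_gt0).
- have := H2 th; rewrite th0 thd2 => /(_ isT) H.
  have -> : 1 / 2 = c * (c * 2)^-1 by field; rewrite gt_eqF.
  by rewrite ler_wpM2l ?(ltW c_gt0).
Qed.

Lemma one_sub_norm_ge : exists2 g : R, 0 < g &
  forall th : R, 0 < th <= pi -> g * th `^ beta <= 1 - `|f th|.
Proof.
have [d [d0 d1 H]] := small_angle; have [g g0 Hg] := f_gap d0.
have pb : 0 < pi `^ beta :> R by rewrite powR_gt0 // pi_gt0.
exists (Num.min (c / 2) (g / pi `^ beta)); first by rewrite lt_min !divr_gt0.
move=> th /andP[th0 thpi]; have [thd|thd] := leP th d.
  have [] := H th; first by rewrite (ltW th0).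
  move=> H1 H2 H3 H4; rewrite H2 in H1.
  have tb : 0 <= th `^ beta by exact: powR_ge0.
  have H5 : C0 * (th `^ beta * th `^ e) <= c / 2 * th `^ beta.
    by rewrite mulrCA mulrC ler_wpM2r.
  move: H1; rewrite ler_norml => /andP[Hl Hu].
  apply: (@le_trans _ _ (c / 2 * th `^ beta)).
    by rewrite ler_wpM2r // ge_min lexx.
  by rewrite ger0_norm; lra.
have := Hg th; rewrite (ltW thd) thpi => /(_ isT).
suff : Num.min (c / 2) (g / pi `^ beta) * th `^ beta <= g by lra.
apply: (@le_trans _ _ (g / pi `^ beta * th `^ beta)).
  by rewrite ler_wpM2r ?powR_ge0 // ge_min lexx orbT.
rewrite mulrAC ler_pdivrMr // ler_wpM2l ?(ltW g0) //.
by apply: ge0_ler_powR; rewrite ?nnegrE ?pi_ge0 // ltW.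
Qed.

Hypothesis beta1 : beta = 1.

Lemma inv_one_sub_norm_le : exists2 C : R, 0 < C & forall th : R, 0 < th <= pi ->
  `|f th| < 1 /\ (1 - `|f th|)^-1 <= (c * th)^-1 + C * th `^ (e - 1).
Proof.
have [d [d0 d1 H]] := small_angle; have [g g0 Hg] := f_gap d0.
have e0 := min_eps_half_gt0; have e1 := min_eps_half_lt1.
(* [C0 / c^2] is the first-order coefficient of the inverse of [c th - C0 th^(1 + e)]; doubling it
   covers the remainder. [B] raises the far bound [1 / g] to [B th^(e - 1)], which is smallest at
   [th = pi]. *)
pose A := 2 * C0 / c ^+ 2; pose B := g^-1 / pi `^ (e - 1).
have pe : 0 < pi `^ (e - 1) :> R by rewrite powR_gt0 // pi_gt0.
have A0 : 0 < A by rewrite /A divr_gt0 ?mulr_gt0 ?exprn_gt0.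
have B0 : 0 < B by rewrite /B divr_gt0 ?invr_gt0.
exists (A + B); first exact: addr_gt0.
move=> th /andP[th0 thpi].
have te : 0 <= th `^ (e - 1) by exact: powR_ge0.
have ict : 0 < (c * th)^-1 by rewrite invr_gt0 mulr_gt0.
have [thd|thd] := leP th d.
  have [] := H th; first by rewrite (ltW th0).
  rewrite beta1 powRr1 ?(ltW th0) // => H1 H2 H3 H4; rewrite H2 in H1.
  have ee : th `^ (e - 1) = th `^ e / th.
    by rewrite powRD ?powR_inv1 ?(ltW th0) //; apply/implyP => _; rewrite gt_eqF.
  move: (th `^ e) (powR_ge0 th e) H1 H3 ee => w w0 H1 H3 ee.
  move: H1; rewrite ler_norml => /andP[Hl Hu].
  have H5 : C0 * (th * w) <= c / 2 * th by rewrite mulrCA mulrC ler_wpM2r // ltW.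
  have ct : 0 < c * th by exact: mulr_gt0.
  have low : c * th - C0 * (th * w) <= 1 - `|f th| by rewrite ger0_norm; lra.
  have lowp : 0 < c * th - C0 * (th * w) by lra.
  split; first by lra.
  apply: (@le_trans _ _ (c * th - C0 * (th * w))^-1).
    by rewrite lef_pV2 ?posrE //; apply: lt_le_trans low.
  apply: (@le_trans _ _ ((c * th)^-1 + A * th `^ (e - 1))); last first.
    by rewrite lerD2l ler_wpM2r // lerDl ltW.
  rewrite -[leLHS]mul1r ler_pdivrMr // ee /A.
  have -> : ((c * th)^-1 + 2 * C0 / c ^+ 2 * (w / th)) * (c * th - C0 * (th * w)) =
    1 + (C0 * w / c ^+ 2) * (c - 2 * (C0 * w)).
    by field; rewrite !gt_eqF.
  rewrite lerDl mulr_ge0 //; last by lra.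
  by rewrite divr_ge0 ?mulr_ge0 ?exprn_ge0 // ltW.
have := Hg th; rewrite (ltW thd) thpi => /(_ isT) Hf.
split; first by lra.
apply: (@le_trans _ _ (B * th `^ (e - 1))); last first.
  by rewrite mulrDl addrA lerDr addr_ge0 ?(ltW ict) // mulr_ge0 ?(ltW A0).
apply: (@le_trans _ _ g^-1).
  by rewrite lef_pV2 ?posrE //; lra.
rewrite /B -mulrA ler_peMr ?invr_ge0 ?(ltW g0) // mulrC ler_pdivlMr // mul1r.
rewrite -opprB !powRN lef_pV2 ?posrE ?powR_gt0 ?pi_gt0 //.
by apply: ge0_ler_powR; rewrite ?nnegrE ?pi_ge0 ?subr_ge0 // ltW.
Qed.

Lemma near_expR : exists C delta lam : R,
  [/\ 0 < C, 0 < delta <= 1, 0 < lam,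
   forall th : R, 0 <= th <= delta ->
     [/\ `|f th - expR (- (c * th))| <= C * th `^ (1 + e), 0 <= f th &
         f th <= expR (- (c * th / 2))]
   & forall th : R, delta <= th <= pi -> `|f th| <= expR (- lam)].
Proof.
have [d [d0 d1 H]] := small_angle; have [g g0 Hg] := f_gap d0.
have e0 := min_eps_half_gt0; have e1 := min_eps_half_lt1.
(* [C0] comes from (A3) and [c^2] from the quadratic remainder of the exponential, where
   [th^2 <= th^(1 + e)]. *)
exists (C0 + c ^+ 2), d, g; split => //.
- by rewrite addr_gt0 ?exprn_gt0.
- by rewrite d0.
- move=> th /andP[th0 thd]; have [] := H th; first by rewrite th0.
  rewrite beta1 powRr1 // => H1 H2 H3 H4.
  have H5 : C0 * (th * th `^ e) <= c / 2 * th by rewrite mulrCA mulrC ler_wpM2r.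
  have ct : 0 <= c * th by rewrite mulr_ge0 // ltW.
  have Q := expRN_quadratic ct.
  have E2 := expR_ge1Dx (- (c * th / 2)).
  split.
  + rewrite (_ : f th - _ = f th - (1 - c * th) - (expR (- (c * th)) - (1 - c * th))); last by ring.
    apply: le_trans (ler_normB _ _) _; rewrite mulrDl; apply: lerD => //.
    apply: le_trans Q _; rewrite exprMn ler_wpM2l ?exprn_ge0 ?(ltW c_gt0) //.
    have [->|tn] := eqVneq th 0; first by rewrite expr0n /= powR_ge0.
    rewrite -powR_mulrn //; apply: ger_powR; first by rewrite lt_neqAle eq_sym tn th0; lra.
    by rewrite -{1}[2]/(1 + 1)%:R natrD; lra.
  + by move: H1; rewrite H2 ler_norml => /andP[]; lra.
  + by move: H1; rewrite H2 ler_norml => /andP[]; lra.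
- move=> th Hth; apply: le_trans (Hg th Hth) _; exact: expR_ge1Dx.
Qed.

End SmallAngle.

(** * Sums over the angles *)

Section AngleSums.
Variable R : realType.
Implicit Types (N j : nat) (s c g beta : R).

Lemma angle_gt0 N j : (0 < N)%N -> (0 < j)%N -> 0 < angle R N j.
Proof. by move=> N0 j0; rewrite /angle divr_gt0 ?mulr_gt0 ?pi_gt0 ?ltr0n. Qed.

Lemma angle_ge0 N j : 0 <= angle R N j.
Proof. by rewrite /angle divr_ge0 ?mulr_ge0 ?pi_ge0. Qed.

Lemma angle_le_pi N j : (0 < N)%N -> (angle R N j <= pi) = (j.*2 <= N)%N.
Proof.
move=> N0; rewrite /angle ler_pdivrMr ?ltr0n // -mulrA mulrCA ler_pM2l ?pi_gt0 //.
by rewrite -natrM ler_nat mul2n.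
Qed.

Lemma angle_ge_ratio N j : (0 < N)%N -> j%:R / N%:R <= angle R N j.
Proof.
move=> N0; rewrite /angle ler_pM2r ?invr_gt0 ?ltr0n // ler_peMl //.
by have := pi_ge2 R; lra.
Qed.

Lemma angle_powRN_le N j s : (0 < N)%N -> (0 < j)%N -> 0 <= s ->
  angle R N j `^ (- s) <= N%:R `^ s * j%:R `^ (- s).
Proof.
move=> N0 j0 s0; have NR : 0 < N%:R :> R by rewrite ltr0n.
have jR : 0 < j%:R :> R by rewrite ltr0n.
have -> : N%:R `^ s * j%:R `^ (- s) = ((j%:R / N%:R) `^ s)^-1 :> R.
  rewrite powRM ?invr_ge0 ?(ltW NR) ?(ltW jR) // -(powR_inv1 (ltW NR)).
  by rewrite -powRrM mulN1r !powRN invfM invrK mulrC.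
rewrite powRN lef_pV2 ?posrE ?powR_gt0 ?(angle_gt0 N0 j0) ?(divr_gt0 jR NR) //.
by apply: ge0_ler_powR; rewrite ?nnegrE ?angle_ge0 ?angle_ge_ratio ?divr_ge0.
Qed.

(** A Riemann sum of the integrable function [th^(s - 1)], hence bounded uniformly in [N]. *)
Lemma sum_angle_powR_le N s : (0 < N)%N -> 0 < s < 1 ->
  2 / N%:R * \sum_(1 <= j < N) angle R N j `^ (s - 1) <= 4 / s.
Proof.
move=> N0 s01; have /andP[s0 s1] := s01; have NR : 0 < N%:R :> R by rewrite ltr0n.
rewrite mulrAC ler_pdivrMr //.
apply: (@le_trans _ _ (2 * (N%:R `^ (1 - s) * (2 / s * N%:R `^ s)))).
  rewrite ler_wpM2l //; apply: le_trans (ler_wpM2l (powR_ge0 _ _) (sum_powR_le N s01)).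
  rewrite mulr_sumr [leLHS]big_nat [leRHS]big_nat; apply: ler_sum => j /andP[j1 jN].
  by rewrite -(opprB 1 s) angle_powRN_le ?subr_ge0 // ltW.
have E : (N%:R : R) = N%:R `^ (1 - s) * N%:R `^ s.
  rewrite -powRD; last by apply/implyP => _; rewrite gt_eqF.
  by rewrite subrK powRr1 ?(ltW NR).
rewrite [in leRHS]E le_eqVlt; apply/orP; left; apply/eqP; field.
by rewrite gt_eqF.
Qed.

(** Source of the sharp constant: [(c t_j)^-1 = N / (2 pi c j)], and the factor 2 for the two halves
    of the frequencies leaves [1 / (c pi)]. *)
Lemma sum_inv_angle N c : (0 < N)%N -> 0 < c ->
  2 / N%:R * \sum_(1 <= j < N) (c * angle R N j)^-1 <= (c * pi)^-1 * (1 + ln N%:R).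
Proof.
move=> N0 c0; have NR : 0 < N%:R :> R by rewrite ltr0n.
have pc : 0 < (c * pi)^-1 :> R by rewrite invr_gt0 mulr_gt0 // pi_gt0.
apply: le_trans (ler_wpM2l (ltW pc) (harmonic_le R N0)).
rewrite !mulr_sumr [leLHS]big_nat [leRHS]big_nat; apply: ler_sum => j /andP[j1 jN].
have jR : 0 < j%:R :> R by rewrite ltr0n.
have := pi_gt0 R; rewrite /angle; move: (pi : R) => q q0.
by rewrite le_eqVlt; apply/orP; left; apply/eqP; field; rewrite !gt_eqF.
Qed.

Lemma exists_nat_between (x : R) : 1 <= x -> exists J, [/\ (0 < J)%N, x <= J%:R & J%:R <= 2 * x].
Proof.
move=> x1; have x0 : 0 <= x by lra.
have /andP[lo hi] := truncn_itv x0.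
by exists (Num.truncn x).+1; split; rewrite ?(ltW hi) // -natr1; lra.
Qed.

(** Without the cap [N + 1], the power [th^(- beta)] would only give order [N^(beta - 1)]; the cap
    controls the lowest frequencies. *)
Lemma sum_min_angle N g beta : (0 < N)%N -> 0 < g -> 1 < beta ->
  2 / N%:R * \sum_(1 <= j < N) Num.min N.+1%:R (g * angle R N j `^ (- beta)) <=
  (8 + 2 * g / (beta - 1)) * N%:R `^ ((beta - 1) / beta).
Proof.
move=> N0 g0 b1; have NR : 0 < N%:R :> R by rewrite ltr0n.
pose t := beta - 1; rewrite -/t.
have t0 : 0 < t by rewrite subr_gt0.
have b0 : 0 < beta by lra.
(* Crossover index: [N] and [(N / j)^beta] agree at [j = x]. Cutting there makes the capped head and
   the tail both of order [N x]. *)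
pose x : R := N%:R `^ (t / beta); rewrite -/x.
have N1 : 1 <= N%:R :> R by rewrite ler1n.
have x1 : 1 <= x by rewrite -(powRr0 N%:R); apply: ler_powR => //; rewrite divr_ge0 // ltW.
have x0 : 0 < x by lra.
have [J [J0 xJ Jx]] := exists_nat_between x1.
have S : \sum_(1 <= j < N) Num.min N.+1%:R (g * angle R N j `^ (- beta)) <=
   N.+1%:R * J%:R + g * N%:R `^ beta * (t^-1 * J%:R `^ (- t)).
  have le1 j : (0 < j)%N -> Num.min N.+1%:R (g * angle R N j `^ (- beta)) <=
      g * N%:R `^ beta * j%:R `^ (- (1 + t)).
    move=> j0; rewrite ge_min; apply/orP; right; rewrite -mulrA ler_wpM2l ?(ltW g0) //.
    have -> : 1 + t = beta by rewrite /t; ring.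
    by rewrite angle_powRN_le // ltW.
  have m0 j : 0 <= Num.min N.+1%:R (g * angle R N j `^ (- beta)).
    by rewrite le_min ler0n mulr_ge0 ?powR_ge0 // ltW.
  have first K : \sum_(1 <= j < K.+1) Num.min N.+1%:R (g * angle R N j `^ (- beta)) <=
      N.+1%:R * K%:R.
    elim: K => [|K IH]; first by rewrite big_geq // mulr0.
    rewrite big_nat_recr //= -[K.+1%:R]natr1 mulrDr mulr1; apply: lerD => //.
    by rewrite ge_min lexx.
  have T0 : 0 <= g * N%:R `^ beta * (t^-1 * J%:R `^ (- t)).
    by rewrite !mulr_ge0 ?powR_ge0 ?invr_ge0 // ltW.
  have [JN|NJ] := leqP J.+1 N; last first.
    have := first N.-1; rewrite prednK // => /le_trans; apply.
    by apply: ler_wpDr => //; rewrite ler_wpM2l // ler_nat; lia.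
  rewrite (@big_cat_nat _ _ _ J.+1) //=; apply: lerD; first exact: first.
  apply: (@le_trans _ _ (g * N%:R `^ beta * \sum_(J.+1 <= j < N) j%:R `^ (- (1 + t)))).
    rewrite mulr_sumr [leLHS]big_nat [leRHS]big_nat; apply: ler_sum => j /andP[j1 jN].
    by apply: le1; lia.
  by rewrite ler_wpM2l ?sum_powR_tail // mulr_ge0 ?powR_ge0 // ltW.
apply: (@le_trans _ _ (2 / N%:R * (N.+1%:R * J%:R + g * N%:R `^ beta * (t^-1 * J%:R `^ (- t))))).
  by rewrite ler_wpM2l // divr_ge0 // ltW.
rewrite [leLHS]mulrDr [leRHS]mulrDl; apply: lerD.
  rewrite mulrAC ler_pdivrMr //.
  have : N.+1%:R <= 2 * N%:R :> R by rewrite -natrM ler_nat; lia.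
  move=> HN; have : N.+1%:R * J%:R <= (2 * N%:R) * (2 * x) by apply: ler_pM.
  by lra.
have JT : J%:R `^ (- t) <= x `^ (- t).
  rewrite !powRN lef_pV2 ?posrE ?powR_gt0 ?ltr0n //.
  by apply: ge0_ler_powR; rewrite ?nnegrE // ltW.
have Nb : N%:R `^ beta = N%:R * N%:R `^ t.
  by rewrite -{2}(powRr1 (ltW NR)) -powRD ?/t; [congr (_ `^ _); ring|apply/implyP => _; rewrite gt_eqF].
have Nx : N%:R `^ t * x `^ (- t) = x.
  rewrite /x -powRrM -powRD; last by apply/implyP => _; rewrite gt_eqF.
  by congr (_ `^ _); rewrite /t; field; rewrite gt_eqF.
have -> : 2 / N%:R * (g * N%:R `^ beta * (t^-1 * J%:R `^ (- t))) =
   2 * g / t * (N%:R `^ t * J%:R `^ (- t)).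
  by rewrite Nb; field; rewrite !gt_eqF.
rewrite ler_wpM2l ?divr_ge0 ?mulr_ge0 ?(ltW g0) ?(ltW t0) //.
by rewrite -[leRHS]Nx ler_wpM2l ?powR_ge0.
Qed.

End AngleSums.

(** * Expected visits bounded by sums over the angles *)

Section VisitsUpper.
Variables (R : realType) (N : nat) (pr : nat -> R) (f : R -> R).
Hypothesis N0 : (0 < N)%N.
Hypothesis pr_ge0 : forall b, 0 <= pr b.
Hypothesis pr_sum1 : \sum_(b < N) pr b = 1.
Hypothesis pr_sin : forall j, \sum_(b < N) pr b * sin (angle R N j * (b%:Z)%:~R) = 0.
Hypothesis f_dft : forall j, f (angle R N j) = dft N pr j.

Lemma dft0 : dft N pr 0 = 1.
Proof.
rewrite -pr_sum1; apply: eq_bigr => b _.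
by rewrite /angle mulr0 !mul0r cos0 mulr1.
Qed.

Lemma conv_pow_le m a :
  conv_pow N pr m a <= N%:R^-1 * \sum_(j < N) `|dft N pr j| ^+ m.
Proof.
rewrite conv_pow_dft // ler_wpM2l ?invr_ge0 //; apply: ler_sum => j _.
apply: le_trans (ler_norm _) _; rewrite normrM normrX ler_piMr ?exprn_ge0 //.
exact: cos_max.
Qed.

(* Each angle [2 pi j / N] with [0 < j < N] or its reflection lies in [(0, pi]],
   so summing [B] over both costs only a factor 2. *)
Lemma visits_le_angle_sum (B : R -> R) y M n x :
  (forall th : R, 0 < th -> 0 <= B th) ->
  (forall th : R, 0 < th <= pi -> \sum_(m < N.+1) `|f th| ^+ m <= B th) ->
  (M <= N)%N ->
  1 + visits N pr y M n x <= 2 + 2 / N%:R * \sum_(1 <= j < N) B (angle R N j).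
Proof.
move=> B0 HB MN; have NR : 0 < N%:R :> R by rewrite ltr0n.
pose S j : R := \sum_(m < N.+1) `|dft N pr j| ^+ m.
apply: (@le_trans _ _ (N%:R^-1 * \sum_(j < N) S j)).
  (* The summand [1] is the term [m = 0], whose average over the frequencies is exactly 1. *)
  rewrite exchange_big /= mulr_sumr big_ord_recl /=; apply: lerD.
    under eq_bigr do rewrite expr0.
    by rewrite sumr_const card_ord mulVf // gt_eqF.
  apply: le_trans (visits_mono N y pr_ge0 n x MN) _; apply: ler_sum => m _.
  exact: (conv_pow_le m.+1).
have SB j : (0 < j < N)%N -> S j <= B (angle R N j) + B (angle R N (N - j)).
  move=> /andP[j0 jN]; have [jh|jh] := leqP j.*2 N.
    apply: ler_wpDr; first by rewrite B0 ?angle_gt0 ?subn_gt0.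
    rewrite /S -f_dft; apply: HB.
    by rewrite angle_gt0 //= angle_le_pi.
  apply: ler_wpDl; first by rewrite B0 ?angle_gt0.
  rewrite /S -(dft_sub pr N0 (ltnW jN)) -f_dft; apply: HB.
  by rewrite angle_gt0 ?subn_gt0 //= angle_le_pi //; lia.
have -> : \sum_(j < N) S j = S 0 + \sum_(1 <= j < N) S j.
  by rewrite -(big_mkord xpredT S) big_ltn.
(* Frequency 0 does not decay; its share [(N + 1) / N] is absorbed in the constant 2. *)
have S0 : S 0 = N.+1%:R.
  rewrite /S dft0 normr1; under eq_bigr do rewrite expr1n.
  by rewrite sumr_const card_ord.
rewrite mulrDr; apply: lerD.
  by rewrite S0 ler_pdivrMl // mulrC -natrM ler_nat; lia.
rewrite [2 / _]mulrC -mulrA ler_wpM2l ?invr_ge0 //.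
rewrite [leRHS](_ : _ = \sum_(1 <= j < N) (B (angle R N j) + B (angle R N (N - j)))).
  by rewrite [leLHS]big_nat [leRHS]big_nat; apply: ler_sum => j; exact: SB.
rewrite big_split /= [X in _ + X]big_nat_rev /=.
rewrite [X in _ + X](_ : _ = \sum_(1 <= j < N) B (angle R N j)); first by ring.
rewrite [LHS]big_nat [RHS]big_nat; apply: eq_bigr => j Hj.
by congr (B (angle R N _)); lia.
Qed.

End VisitsUpper.

(** * Local lower bound *)

Section LocalLower.
Variable R : realType.
Implicit Types (N m j : nat) (a : int) (c : R).

(** With [w = m / N], the numerator of the Poisson kernel is at least of order [w] and its
    denominator at most of order [w^2], which leaves [N / m]. *)
Lemma poisson_lower N m a c (r : R) : 0 < c -> 1 <= c * m%:R -> (m <= N)%N -> `|a| <= m%:Z ->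
  r = expR (- (2 * pi * c * m%:R / N%:R)) ->
  c / (4 * pi * (1 + 2 * pi * c) * (1 + c ^+ 2)) * (N%:R / m%:R) <=
  \sum_(j < N) (r ^+ j + r ^+ (N - j)) * cos (angle R N j * a%:~R).
Proof.
move=> c0 cm mN am rdef.
have m0 : (0 < m)%N.
  by rewrite lt0n; apply/eqP => E; move: cm; rewrite E mulr0 ler10.
have N0 : (0 < N)%N by exact: leq_trans mN.
have NR : 0 < N%:R :> R by rewrite ltr0n.
have mR : 0 < m%:R :> R by rewrite ltr0n.
pose w : R := m%:R / N%:R.
have w0 : 0 < w by rewrite divr_gt0.
have w1 : w <= 1 by rewrite ler_pdivrMr // mul1r ler_nat.
pose x : R := 2 * pi * c * w.
have p0 := pi_gt0 R.
have tp : 0 < 2 * pi :> R by rewrite mulr_gt0.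
have x0 : 0 < x by exact: mulr_gt0 (mulr_gt0 tp c0) w0.
have rE : r = expR (- x) by rewrite rdef /x /w mulrA.
have r0 : 0 < r by rewrite rE expR_gt0.
have r1 : r < 1 by rewrite rE expR_lt1 oppr_lt0.
pose al : R := 2 * pi * a%:~R / N%:R.
have jal j : angle R N j * a%:~R = j%:R * al by rewrite /angle /al; ring.
have Nal : N%:R * al = 0 + 2 * pi * a%:~R by rewrite /al; field; rewrite gt_eqF.
under eq_bigr do rewrite jal.
have := @poisson_sum R N r al; rewrite Nal cosD2piz sinD2piz cos0 sin0 => /(_ erefl erefl).
set S := \sum_(j < N) _; set D := 1 - _ + _ => HS.
have al2 : al ^+ 2 <= (2 * pi * w) ^+ 2.
  rewrite -[leLHS]real_normK ?num_real // lerXn2r ?nnegrE //.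
    by rewrite !mulr_ge0 ?(ltW p0) ?(ltW w0).
  rewrite /al /w normrM (ger0_norm (_ : 0 <= N%:R^-1)) ?invr_ge0 // mulrA.
  rewrite ler_wpM2r ?invr_ge0 // normrM (ger0_norm (_ : 0 <= 2 * pi)) ?mulr_ge0 ?(ltW p0) //.
  rewrite ler_wpM2l ?mulr_ge0 ?(ltW p0) //.
  by rewrite -intr_norm -[m%:R]/(m%:Z%:~R) ler_int.
(* Both pieces are of order [w^2]: the first because [1 - r <= x], the second because [|a| <= m]
   bounds [al] by [2 pi w]. *)
have DE : D = (1 - r) ^+ 2 + r * (2 * (1 - cos al)) by rewrite /D; ring.
have rx : 1 - r <= x by rewrite rE; have := expR_ge1Dx (- x); lra.
have c2 := one_sub_cos_le al; have c3 := cos_le1 al.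
have D0 : 0 < D.
  rewrite DE; apply: ltr_pwDl; first by rewrite exprn_gt0 // subr_gt0.
  by rewrite mulr_ge0 ?(ltW r0) //; lra.
have Dle : D <= (2 * pi * w) ^+ 2 * (1 + c ^+ 2).
  rewrite DE [leRHS]mulrDr mulr1 [leLHS]addrC; apply: lerD.
    apply: le_trans al2; apply: le_trans c2; rewrite ler_piMl ?(ltW r1) //; lra.
  rewrite -exprMn lerXn2r ?nnegrE ?subr_ge0 ?(ltW r1) //.
    by rewrite !mulr_ge0 ?(ltW p0) ?(ltW w0) ?(ltW c0).
  by rewrite mulrAC.
(* [r ^+ N] is [exp (- 2 pi c m)], so [1 <= c * m] is what keeps it away from 1. *)
have rN : r ^+ N <= 2^-1.
  have -> : r ^+ N = expR (- (2 * pi * c * m%:R)).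
    by rewrite rdef -expRM_natl; congr expR; field; rewrite gt_eqF.
  have big : 1 <= 2 * pi * c * m%:R.
    rewrite -mulrA; apply: le_trans cm _; rewrite ler_peMl ?mulr_ge0 ?(ltW c0) //.
    by have := pi_ge2 R; lra.
  have := ger_one_sub_expRN (le_trans ler01 big).
  suff : 2^-1 <= 2 * pi * c * m%:R / (1 + 2 * pi * c * m%:R) by lra.
  by rewrite ler_pdivlMr; lra.
have Q0 : 0 < 1 + 2 * pi * c by rewrite addr_gt0 ?mulr_gt0.
have num : pi * c * w / (1 + 2 * pi * c) <= (1 - r ^+ N) * (1 - r ^+ 2).
  have H1 : x / (1 + 2 * pi * c) <= 1 - r.
    rewrite rE; apply: le_trans (ger_one_sub_expRN (ltW x0)).
    rewrite ler_wpM2l ?(ltW x0) // lef_pV2 ?posrE ?(addr_gt0 ltr01 x0) // lerD2l /x.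
    by rewrite ler_piMr // ?mulr_ge0 ?(ltW p0) ?(ltW c0).
  have -> : pi * c * w / (1 + 2 * pi * c) = 2^-1 * (x / (1 + 2 * pi * c)).
    by rewrite /x; move: (pi : R) p0 Q0 => q q0 Q0; field; rewrite gt_eqF.
  apply: ler_pM => //; first by rewrite divr_ge0 ?(ltW x0) ?(ltW Q0).
    lra.
  apply: le_trans H1 _; rewrite lerD2l lerN2 expr2 ler_piMl ?(ltW r0) ?(ltW r1) //.
rewrite -(ler_pM2l D0) HS; apply: le_trans num.
have C0 : 0 < 1 + c ^+ 2 by rewrite addr_gt0 ?exprn_gt0.
set k := c / _; have k0 : 0 < k.
  by rewrite /k divr_gt0 // (mulr_gt0 (mulr_gt0 _ Q0) C0) // mulr_gt0.
have -> : N%:R / m%:R = w^-1 by rewrite /w invf_div.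
apply: (@le_trans _ _ ((2 * pi * w) ^+ 2 * (1 + c ^+ 2) * (k / w))).
  by rewrite ler_wpM2r // divr_ge0 ?(ltW k0) ?(ltW w0).
rewrite le_eqVlt; apply/orP; left; apply/eqP; rewrite /k.
move: (pi : R) p0 Q0 => q q0 Q0; clear -q0 Q0 C0 w0.
by field; rewrite !gt_eqF.
Qed.

Variables (f : R -> R) (c e C delta lam : R).
Hypotheses (c_gt0 : 0 < c) (e_gt0 : 0 < e) (e_lt1 : e < 1) (C_gt0 : 0 < C).
Hypotheses (delta_gt0 : 0 < delta) (delta_le1 : delta <= 1) (lam_gt0 : 0 < lam).
Hypothesis f_near : forall th : R, 0 <= th <= delta ->
  [/\ `|f th - expR (- (c * th))| <= C * th `^ (1 + e), 0 <= f th &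
      f th <= expR (- (c * th / 2))].
Hypothesis f_far : forall th : R, delta <= th <= pi -> `|f th| <= expR (- lam).

(** A common decay rate in [m], at angles above [delta], for [f th ^+ m] and for its exponential
    model. *)
Let lam0 := Num.min lam (c * delta).

(** Beyond [delta] both terms are exponentially small. Below it, the difference of powers costs
    [m th^(1 + e) = m^(- e) (m th)^(1 + e)]: the factor [m^(- e)] is the gain, and the other one
    only lowers the exponential rate from [c / 4] to [c / 8]. *)
Lemma pow_near_expR : exists2 C1 : R, 0 < C1 & forall (m : nat) (th : R),
  (1 < m)%N -> 0 <= th <= pi ->
  `|f th ^+ m - expR (- (c * m%:R * th))| <=
    2 * expR (- (lam0 * m%:R)) + C1 * m%:R `^ (- e) * expR (- (c / 8 * m%:R * th)).
Proof.
have c8 : 0 < c / 8 by rewrite divr_gt0.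
have e01 : 0 <= e <= 1 by rewrite !ltW.
have [K K0 HK] := powR_le_expR e01 c8.
exists (C * K); first exact: mulr_gt0.
move=> m th m1 /andP[th0 thpi].
have mR : 0 < m%:R :> R by rewrite ltr0n ltnW.
have cth : 0 <= c * th by rewrite mulr_ge0 // ltW.
have [thd|thd] := leP th delta; last first.
  apply: ler_wpDr.
    by rewrite !mulr_ge0 ?powR_ge0 ?expR_ge0 ?(ltW C_gt0) ?(ltW K0).
  apply: le_trans (ler_normB _ _) _; rewrite mulr_natl mulr2n; apply: lerD.
    rewrite normrX; apply: (@le_trans _ _ (expR (- lam) ^+ m)).
      by rewrite lerXn2r ?nnegrE ?expR_ge0 // f_far // thpi (ltW thd).
    rewrite -expRM_natl ler_expR mulrN lerN2 mulrC ler_wpM2l //.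
    by rewrite ge_min lexx.
  rewrite ger0_norm ?expR_ge0 // ler_expR lerN2 mulrAC ler_wpM2r //.
  apply: (@le_trans _ _ (c * delta)); first by rewrite ge_min lexx orbT.
  by rewrite ler_wpM2l ?ltW.
apply: ler_wpDl; first by rewrite mulr_ge0 ?expR_ge0.
have [H1 H2 H3] : [/\ `|f th - expR (- (c * th))| <= C * th `^ (1 + e), 0 <= f th &
      f th <= expR (- (c * th / 2))] by apply: f_near; rewrite th0.
have -> : expR (- (c * m%:R * th)) = expR (- (c * th)) ^+ m.
  by rewrite -expRM_natl; congr expR; ring.
apply: le_trans (@ler_dist_exprn R _ _ (expR (- (c * th / 2))) _ _ _) _.
- by rewrite H2.
- by rewrite expR_ge0 ler_expR lerN2; lra.
(* The power is [m - 1]; as [m >= 2] it is at least [m / 2], which turns the rate [c / 2] into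
   [c / 4]. *)
apply: (@le_trans _ _ (m%:R * (C * th `^ (1 + e)) * expR (- (c / 4 * m%:R * th)))).
  apply: ler_pM; rewrite ?mulr_ge0 ?exprn_ge0 ?expR_ge0 //.
    by rewrite ler_wpM2l.
  rewrite -expRM_natl ler_expR mulrN lerN2.
  have -> : c / 4 * m%:R * th = m%:R / 2 * (c * th / 2) by field.
  rewrite ler_wpM2r //; first by rewrite divr_ge0.
  by rewrite ler_pdivrMr // -natrM ler_nat; move: m1; clear; lia.
have := HK (m%:R * th) (mulr_ge0 (ltW mR) th0).
rewrite powRM // ?(ltW mR) // => HK'.
have E8 : expR (- (c / 8 * m%:R * th)) =
    expR (c / 8 * (m%:R * th)) * expR (- (c / 4 * m%:R * th)).
  by rewrite -expRD; congr expR; field.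
rewrite E8 [leRHS]mulrA ler_wpM2r ?expR_ge0 //.
have me : m%:R `^ (- e) * m%:R `^ (1 + e) = m%:R :> R.
  rewrite -powRD; last by apply/implyP => _; rewrite gt_eqF.
  by rewrite addrCA addNr addr0 powRr1 ?(ltW mR).
rewrite -{1}me.
have -> : m%:R `^ (- e) * m%:R `^ (1 + e) * (C * th `^ (1 + e)) =
  C * m%:R `^ (- e) * (m%:R `^ (1 + e) * th `^ (1 + e)) by ring.
have -> : C * K * m%:R `^ (- e) * expR (c / 8 * (m%:R * th)) =
  C * m%:R `^ (- e) * (K * expR (c / 8 * (m%:R * th))) by ring.
by rewrite ler_wpM2l // mulr_ge0 ?powR_ge0 // ltW.
Qed.

Lemma conv_pow_local_lower : exists kap : R, exists m0 : nat,
  [/\ 0 < kap, (0 < m0)%N & forall N (pr : nat -> R), (0 < N)%N ->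
  (forall j, \sum_(b < N) pr b * sin (angle R N j * (b%:Z)%:~R) = 0) ->
  (forall j, f (angle R N j) = dft N pr j) ->
  forall m a, (m0 <= m)%N -> (m <= N)%N -> `|a| <= m%:Z ->
  kap / m%:R <= conv_pow N pr m a].
Proof.
have [C1 C10 H1] := pow_near_expR.
have p0 := pi_gt0 R.
have l0 : 0 < lam0 by rewrite lt_min lam_gt0 mulr_gt0.
have e01 : 0 <= e <= 1 by rewrite !ltW.
have [K K0 HK] := powR_le_expR e01 l0.
pose kap0 := c / (4 * pi * (1 + 2 * pi * c) * (1 + c ^+ 2)).
have k0 : 0 < kap0.
  rewrite /kap0 divr_gt0 // mulr_gt0 //; last by rewrite addr_gt0 ?exprn_gt0.
  by rewrite mulr_gt0 // ?mulr_gt0 // addr_gt0 // !mulr_gt0.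
(* [C2 * (N / m)] will bound a geometric sum of ratio [expR (- z)], [z = pi c m / (4 N)], through
   [(1 + z) / z] and [z <= pi c / 4]. *)
pose C2 : R := (1 + pi * c / 4) * (4 / (pi * c)).
have pc : 0 < pi * c by exact: mulr_gt0.
have C20 : 0 < C2 by rewrite /C2 mulr_gt0 ?addr_gt0 ?divr_gt0.
(* Total error relative to [m^(- e) N / m]: each of two sums of [E] costs [6 K] for the exponential
   term and [C1 * C2] for the geometric one. *)
pose C3 := 12 * K + 2 * C1 * C2.
have C30 : 0 < C3.
  exact: addr_gt0 (mulr_gt0 (ltr0n R 12) K0) (mulr_gt0 (mulr_gt0 (ltr0n R 2) C10) C20).
have k3 : 0 < kap0 / 2 / C3 by exact: divr_gt0 (divr_gt0 k0 (ltr0n R 2)) C30.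
have [d d0 Hd] := powR_small e_gt0 k3.
(* Half of the main term survives. The three thresholds on [m] serve [pow_near_expR], the smallness
   of the error, and [1 <= c * m]. *)
exists (kap0 / 2), (maxn 2 (maxn (Num.truncn d^-1).+1 (Num.truncn c^-1).+1)).
split; [by rewrite divr_gt0|by rewrite leq_max|].
move=> N pr N0 prs fd m a; rewrite !geq_max => /and3P[m2 md mc] mN am.
have mR : 0 < m%:R :> R by rewrite ltr0n ltnW.
have NR : 0 < N%:R :> R by rewrite ltr0n.
have cm : 1 <= c * m%:R.
  rewrite mulrC -ler_pdivrMr // div1r; apply: ltW; apply: lt_le_trans (truncnS_gt _) _.
  by rewrite ler_nat.
have small : C3 * m%:R `^ (- e) <= kap0 / 2.
  rewrite mulrC -ler_pdivlMr // powRN -powR_inv1 ?powR_ge0 // -powRrM mulrN1 -mulN1r powRrM.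
  rewrite powR_inv1 ?(ltW mR) //; apply: Hd; rewrite invr_ge0 (ltW mR) /=.
  rewrite -[d]invrK lef_pV2 ?posrE ?invr_gt0 //.
  by apply: ltW; apply: lt_le_trans (truncnS_gt _) _; rewrite ler_nat.
pose r : R := expR (- (2 * pi * c * m%:R / N%:R)).
have rj j : r ^+ j = expR (- (c * m%:R * angle R N j)).
  by rewrite /r -expRM_natl /angle; congr expR; ring.
pose u j := r ^+ j + r ^+ (N - j).
pose E j := 3 * expR (- (lam0 * m%:R)) +
   C1 * m%:R `^ (- e) * expR (- (c / 8 * m%:R * angle R N j)).
have Ege j : 0 <= E j.
  by rewrite /E addr_ge0 ?mulr_ge0 ?expR_ge0 ?powR_ge0 ?(ltW C10).
have half j : (j.*2 <= N)%N -> `|dft N pr j ^+ m - u j| <= E j.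
  move=> jN; rewrite -fd /u opprD addrA.
  apply: le_trans (ler_normB _ _) _.
  rewrite (_ : E j = (2 * expR (- (lam0 * m%:R)) + C1 * m%:R `^ (- e) *
    expR (- (c / 8 * m%:R * angle R N j))) + expR (- (lam0 * m%:R))); last by rewrite /E; ring.
  apply: lerD; first by rewrite rj; apply: H1; rewrite ?angle_ge0 ?angle_le_pi.
  (* For [j <= N / 2] the reflected power sits at an angle above [pi], hence above [delta]; it
     provides the third copy of [expR (- (lam0 * m))] in [E]. *)
  rewrite ger0_norm ?exprn_ge0 ?expR_ge0 // rj ler_expR lerN2 mulrAC ler_wpM2r //.
  apply: (@le_trans _ _ (c * delta)); first by rewrite ge_min lexx orbT.
  rewrite ler_wpM2l ?(ltW c_gt0) //; apply: le_trans delta_le1 _.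
  apply: (@le_trans _ _ pi); first by have := pi_ge2 R; lra.
  rewrite /angle ler_pdivlMr // -mulrA mulrCA ler_wpM2l ?(ltW p0) //.
  by rewrite -natrM ler_nat; move: jN; clear; lia.
have usub j : (j <= N)%N -> u (N - j)%N = u j by move=> jN; rewrite /u subKn // addrC.
(* One of [j] and [N - j] lies in the range of [half]; charging both errors avoids splitting the
   sum. *)
have err j : (j < N)%N -> `|dft N pr j ^+ m - u j| <= E j + E (N - j)%N.
  move=> jN; have [jh|jh] := leqP j.*2 N.
    by apply: ler_wpDr; rewrite ?half.
  apply: ler_wpDl => //; rewrite -(dft_sub pr N0 (ltnW jN)) -usub ?(ltnW jN) //.
  by apply: half; move: jh jN; clear; lia.
have sumE : \sum_(j < N.+1) E j <= N%:R * (6 * expR (- (lam0 * m%:R)) +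
    C1 * C2 * m%:R `^ (- e) / m%:R).
  rewrite big_split /= sumr_const card_ord mulrDr; apply: lerD.
    rewrite -[leLHS]mulr_natr.
    have HN : N.+1%:R <= 2 * N%:R :> R by rewrite -natrM ler_nat; move: N0; clear; lia.
    have -> : N%:R * (6 * expR (- (lam0 * m%:R))) = 3 * expR (- (lam0 * m%:R)) * (2 * N%:R).
      by ring.
    by rewrite ler_wpM2l // mulr_ge0 ?expR_ge0.
  rewrite -mulr_sumr.
  pose z := pi * c / 4 * (m%:R / N%:R).
  have z0 : 0 < z by exact: mulr_gt0 (divr_gt0 pc (ltr0n R 4)) (divr_gt0 mR NR).
  have z1 : z <= pi * c / 4.
    by rewrite /z ler_piMr ?divr_ge0 ?mulr_ge0 ?(ltW p0) ?(ltW c_gt0) // ler_pdivrMr // mul1r ler_nat.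
  have h01 : 0 <= expR (- z) < 1 by rewrite expR_ge0 expR_lt1 oppr_lt0.
  rewrite (eq_bigr (fun j : 'I_N.+1 => expR (- z) ^+ j)) => [|j _]; last first.
    by rewrite -expRM_natl /z /angle; congr expR; field; rewrite gt_eqF.
  have -> : N%:R * (C1 * C2 * m%:R `^ (- e) / m%:R) =
     C1 * m%:R `^ (- e) * (C2 * (N%:R / m%:R)) by ring.
  rewrite ler_wpM2l ?mulr_ge0 ?powR_ge0 ?(ltW C10) //.
  apply: le_trans (sum_expr_le _ h01) _.
  have := ger_one_sub_expRN (ltW z0) => Hz.
  have zz : 0 < z / (1 + z) by rewrite divr_gt0 // addr_gt0.
  apply: (@le_trans _ _ (z / (1 + z))^-1).
    by rewrite lef_pV2 ?posrE //; apply: lt_le_trans Hz.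
  rewrite invf_div /C2 -mulrA ler_pM ?invr_ge0 ?(ltW z0) ?addr_ge0 ?(ltW z0) ?lerD2l //.
  rewrite /z le_eqVlt; apply/orP; left; apply/eqP.
  move: (pi : R) p0 => q q0; field; rewrite !gt_eqF //.
have expm : expR (- (lam0 * m%:R)) <= K * m%:R `^ (- e) / m%:R.
  have := HK m%:R (ltW mR).
  rewrite powRD ?powRr1 ?(ltW mR) //; last by apply/implyP => _; rewrite gt_eqF.
  move=> H; rewrite expRN powRN -mulrA -invfM -[leLHS]mul1r ler_pdivrMr ?expR_gt0 //.
  rewrite mulrAC ler_pdivlMr ?mulr_gt0 ?powR_gt0 // mul1r; apply: le_trans H.
  by rewrite mulrC.
rewrite conv_pow_dft // ler_pdivlMl // .
apply: (@le_trans _ _ (kap0 * (N%:R / m%:R) - 2 * \sum_(j < N.+1) E j)).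
  have -> : N%:R * (kap0 / 2 / m%:R) = kap0 * (N%:R / m%:R) - N%:R * (kap0 / 2 / m%:R) by field; rewrite gt_eqF.
  rewrite lerD2l lerN2; apply: (@le_trans _ _ (N%:R * (C3 * m%:R `^ (- e) / m%:R))); last first.
    by rewrite ler_wpM2l // ler_wpM2r // invr_ge0 ltW.
  apply: (@le_trans _ _ (2 * (N%:R * (6 * expR (- (lam0 * m%:R)) +
    C1 * C2 * m%:R `^ (- e) / m%:R)))); first by rewrite ler_wpM2l.
  rewrite mulrCA ler_wpM2l // /C3.
  have -> : (12 * K + 2 * C1 * C2) * m%:R `^ (- e) / m%:R =
    12 * (K * m%:R `^ (- e) / m%:R) + 2 * (C1 * C2 * m%:R `^ (- e) / m%:R) by ring.
  move: expm; move: (expR _) (K * _ / _) (C1 * _ * _ / _) => A B D; lra.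
have PL := poisson_lower c_gt0 cm mN am (erefl r); rewrite -/kap0 in PL.
have -> : \sum_(j < N) dft N pr j ^+ m * cos (angle R N j * a%:~R) =
  \sum_(j < N) u j * cos (angle R N j * a%:~R) +
  \sum_(j < N) (dft N pr j ^+ m - u j) * cos (angle R N j * a%:~R).
  by rewrite -big_split /=; apply: eq_bigr => j _; ring.
apply: lerD => //; rewrite lerNl -sumrN.
apply: (@le_trans _ _ (\sum_(j < N) (E j + E (N - j)%N))).
  apply: ler_sum => j _; apply: le_trans (err j (ltn_ord j)).
  rewrite -mulNr; apply: le_trans (ler_norm _) _; rewrite normrM normrN ler_piMr //.
  exact: cos_max.
rewrite big_split /= mulr_natl mulr2n; apply: lerD.
  by rewrite big_ord_recr /= lerDl.
rewrite (reindex_inj rev_ord_inj) big_ord_recl /=; apply: ler_wpDl => //.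
apply: ler_sum => j _; rewrite /bump leq0n add1n subKn //; exact: ltn_ord.
Qed.

End LocalLower.

(** * Bounds on the hitting probability *)

Lemma sum_norm_expr_le (R : realType) (x : R) M : `|x| < 1 ->
  \sum_(m < M) `|x| ^+ m <= (1 - `|x|)^-1.
Proof. by move=> x1; apply: sum_expr_le; rewrite normr_ge0. Qed.

Section RabbitBounds.
Variables (d : measure_display) (T : measurableType d) (R : realType).
Variables (P : probability T R) (X : nat -> T -> int).
Hypothesis Xm : iid_discrete_rvs X.
Hypothesis Xid : iid_ident_distr P X.
Hypothesis Xind : iid_mutually_indep P X.
Let p := step_law P X.
Hypothesis p_aper : strongly_aperiodic p.
Hypothesis p_sym : symmetric_law p.
Variables beta cst eps : R.
Hypothesis p_A3 : A3 p beta cst eps.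

Let f := phi_re p.

Lemma phi_gap (delta : R) : 0 < delta ->
  exists2 g : R, 0 < g & forall th : R, delta <= th <= pi -> `|f th| <= 1 - g.
Proof.
apply: phi_re_gap => //; first exact: step_law_ge0.
exact: cvg_step_law1.
Qed.

Lemma A3_real : exists C delta : R, [/\ 0 < C, 0 < delta &
  forall th, `|th| < delta ->
  `|f th - (1 - cst * `|th| `^ beta)| <= C * `|th| `^ (beta + eps)].
Proof.
case: p_A3 => _ _ _ _ [C [delta [C0 [d0 H]]]]; exists C, delta; split => // th /H.
by apply: le_trans; rewrite -sqrtr_sqr ler_wsqrtr // lerDl sqr_ge0.
Qed.

Lemma hit_prob_ge (B : R -> R) (K : R) N y : (0 < N)%N -> 0 < K ->
  (forall th : R, 0 < th -> 0 <= B th) ->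
  (forall th : R, 0 < th <= pi -> \sum_(m < N.+1) `|f th| ^+ m <= B th) ->
  2 + 2 / N%:R * \sum_(1 <= j < N) B (angle R N j) <= K ->
  K^-1 <= hit_prob P X N y.
Proof.
move=> N0 K0 B0 HB BK; rewrite hit_probE //; apply: mean_hit_ge => //.
- exact: residue_law_ge0.
- exact: sum_residue_law.
move=> n M MN; apply: le_trans BK; apply: (@visits_le_angle_sum R N _ f) => //.
- exact: residue_law_ge0.
- exact: sum_residue_law.
- by move=> j; exact: residue_law_sin.
- by move=> j; exact: phi_re_angle.
Qed.

Lemma sum_norm_phi_le : exists2 g : R, 0 < g & forall M (th : R), 0 < th <= pi ->
  \sum_(m < M) `|f th| ^+ m <= g * th `^ (- beta).
Proof.
case: (p_A3) => b0 _ c0 e0 _; have [C [dl [C0 d0 H]]] := A3_real.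
have [g g0 Hg] := one_sub_norm_ge b0 c0 e0 C0 d0 H phi_gap.
exists g^-1 => [|M th th0]; first by rewrite invr_gt0.
have tb : 0 < g * th `^ beta by case/andP: th0 => ? _; rewrite mulr_gt0 ?powR_gt0.
have Hth := Hg th th0.
apply: le_trans (sum_norm_expr_le M _) _; first by lra.
by rewrite powRN -invfM lef_pV2 ?posrE //; apply: lt_le_trans Hth.
Qed.

(** For [beta < 1] the bound [th^(- beta)] is integrable at 0, so its average over the angles is
    bounded in [N]. *)
Lemma hit_prob_lower_lt1 : beta < 1 -> exists c1 : R, 0 < c1 /\
  forall (N : nat) (y : nat -> int), (2 <= N)%N -> c1 <= hit_prob P X N y.
Proof.
move=> b1; case: (p_A3) => b0 _ _ _ _; have [g g0 Hg] := sum_norm_phi_le.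
have s01 : 0 < 1 - beta < 1 by apply/andP; split; lra.
have /andP[s0 _] := s01.
have K0 : 0 < 2 + g * (4 / (1 - beta)).
  exact: addr_gt0 (ltr0n R 2) (mulr_gt0 g0 (divr_gt0 (ltr0n R 4) s0)).
exists (2 + g * (4 / (1 - beta)))^-1; split; first by rewrite invr_gt0.
move=> N y N2; have N0 : (0 < N)%N by exact: ltnW.
apply: (hit_prob_ge y N0 K0 (B := fun th => g * th `^ (- beta))).
- by move=> th _; rewrite mulr_ge0 ?powR_ge0 // ltW.
- by move=> th; exact: Hg.
rewrite lerD2l -mulr_sumr mulrCA ler_wpM2l ?(ltW g0) //.
have := sum_angle_powR_le N0 s01; congr (_ * _ <= _).
by apply: eq_bigr => j _; congr (_ `^ _); ring.
Qed.

Lemma hit_prob_lower_gt1 : 1 < beta -> exists c4 : R, 0 < c4 /\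
  forall (N : nat) (y : nat -> int), (2 <= N)%N ->
  c4 / (N%:R `^ ((beta - 1) / beta)) <= hit_prob P X N y.
Proof.
move=> b1; have [g g0 Hg] := sum_norm_phi_le.
have bb : 0 < beta - 1 by rewrite subr_gt0.
pose c := 8 + 2 * g / (beta - 1).
have c0 : 0 < c by exact: addr_gt0 (ltr0n R 8) (divr_gt0 (mulr_gt0 (ltr0n R 2) g0) bb).
have c20 : 0 < 2 + c by exact: addr_gt0.
exists (2 + c)^-1; split; first by rewrite invr_gt0.
move=> N y N2; have N0 : (0 < N)%N by exact: ltnW.
set x : R := _ `^ _.
have x1 : 1 <= x.
  rewrite -(powRr0 N%:R); apply: ler_powR; first by rewrite ler1n.
  by rewrite divr_ge0 ?(ltW bb) // ltW // (lt_trans ltr01).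
have x0 : 0 < x by exact: lt_le_trans x1.
rewrite -invfM.
apply: (hit_prob_ge y N0 (mulr_gt0 c20 x0)
          (B := fun th => Num.min N.+1%:R (g * th `^ (- beta)))).
- by move=> th _; rewrite le_min ler0n mulr_ge0 ?powR_ge0 // ltW.
(* The cap counts the [N + 1] powers, each at most 1: the gap lemma at [delta = th] gives
   [|f th| < 1]. *)
- move=> th th0; rewrite le_min Hg // andbT.
  rewrite -[leRHS]mulr1 mulr_natl -[N.+1 in leRHS]card_ord -sumr_const.
  apply: ler_sum => m _; apply: exprn_ile1 => //.
  case: (p_A3) => b0 _ _ _ _; case/andP: th0 => th0 thpi.
  have [g' g'0 H] := phi_gap th0.
  by have := H th; rewrite lexx thpi => /(_ isT); lra.
rewrite [leRHS]mulrDl; apply: lerD; last exact: sum_min_angle.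
by rewrite ler_peMr.
Qed.

Hypothesis beta1 : beta = 1.

Lemma hit_prob_lower_eq1 : exists c2 : R, 0 < c2 /\
  forall (N : nat) (y : nat -> int), (2 <= N)%N ->
  1 / ((cst * pi)^-1 * ln N%:R + c2) <= hit_prob P X N y.
Proof.
case: (p_A3) => b0 _ c0 e0 _; have [C' [dl [C'0 d0 H]]] := A3_real.
have [C C0 HC] := inv_one_sub_norm_le b0 c0 e0 C'0 d0 H phi_gap beta1.
set e := Num.min eps 2^-1 in HC.
have ee0 : 0 < e := min_eps_half_gt0 e0.
have ee1 : e < 1 := min_eps_half_lt1 eps.
have pc : 0 < (cst * pi)^-1 by rewrite invr_gt0 mulr_gt0 // pi_gt0.
have C4 : 0 < C * (4 / e) by exact: mulr_gt0 C0 (divr_gt0 (ltr0n R 4) ee0).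
(* In order: the constant of the visit bound, the [1] in [1 + ln N], and the averaged error
   [C th^(e - 1)]. *)
pose c2 := 2 + (cst * pi)^-1 + C * (4 / e).
have c20 : 0 < c2 by exact: addr_gt0 (addr_gt0 (ltr0n R 2) pc) C4.
exists c2; split => // N y N2; have N0 : (0 < N)%N by exact: ltnW.
have lnN : 0 <= ln N%:R :> R by rewrite ln_ge0 // ler1n.
have K0 : 0 < (cst * pi)^-1 * ln N%:R + c2.
  by apply: ltr_wpDl => //; rewrite mulr_ge0 // ltW.
rewrite div1r; apply: (hit_prob_ge y N0 K0
  (B := fun th => (cst * th)^-1 + C * th `^ (e - 1))).
- by move=> th th0; rewrite addr_ge0 ?invr_ge0 ?mulr_ge0 ?powR_ge0 // ltW.
- move=> th th0; have [f1 Hf] := HC th th0.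
  by apply: le_trans (sum_norm_expr_le _ f1) Hf.
rewrite big_split /= mulrDr -mulr_sumr.
have S1 := sum_inv_angle N0 c0.
have e01 : 0 < e < 1 by rewrite ee0.
have S2 := ler_wpM2l (ltW C0) (sum_angle_powR_le N0 e01).
rewrite mulrCA in S2.
rewrite /c2 [leRHS](_ : _ = 2 + ((cst * pi)^-1 * (1 + ln N%:R) + C * (4 / e))); last by ring.
by rewrite lerD2l; exact: lerD.
Qed.

Lemma hit_prob_upper_eq1 : exists c3 : R, 0 < c3 /\
  forall (N : nat) (y : nat -> int), (2 <= N)%N ->
  (forall n, (1 <= n)%N -> (n < N)%N -> `|y n - y n.+1| <= 1) ->
  hit_prob P X N y <= c3 / ln N%:R.
Proof.
case: (p_A3) => b0 _ c0 e0 _; have [C' [dl [C'0 d0 H]]] := A3_real.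
have [C [de [lam [C0 /andP[de0 de1] lam0 Hn Hf]]]] :=
  near_expR b0 c0 e0 C'0 d0 H phi_gap beta1.
have [kap [m0 [kap0 m00 HL]]] := conv_pow_local_lower c0 (min_eps_half_gt0 e0)
  (min_eps_half_lt1 eps) C0 de0 de1 lam0 Hn Hf.
have lnm : 0 <= ln m0%:R :> R by rewrite ln_ge0 // ler1n.
have lnm1 : 0 < 1 + ln m0%:R :> R by exact: ltr_wpDr.
(* The second entry gives [k * ln m0 <= 1]: the hit itself pays for the first [m0] times, where no
   local bound is available. *)
pose k := Num.min kap (1 + ln m0%:R)^-1.
have k0 : 0 < k by rewrite lt_min kap0 invr_gt0.
have kkap : k <= kap by rewrite ge_min lexx.
have km : k * ln m0%:R <= 1.
  apply: (@le_trans _ _ ((1 + ln m0%:R)^-1 * (1 + ln m0%:R))); last by rewrite mulVf // gt_eqF.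
  apply: ler_pM => //; first exact: ltW.
    by rewrite ge_min lexx orbT.
  by rewrite lerDr.
exists (2 / k); split; first exact: divr_gt0.
move=> N y N2 Hy; have N0 : (0 < N)%N by exact: ltnW.
have lnN : 0 < ln N%:R :> R by rewrite ln_gt0 // ltr1n.
(* Freezing the agent after time N lets the visits be counted up to time 2N. *)
pose y' n := y (minn n N).
have step n : (0 < n)%N -> `|y' n.+1 - y' n| <= 1.
  move=> n0; have [nN|Nn] := ltnP n N; rewrite /y'.
    by rewrite (minn_idPl nN) (minn_idPl (ltnW nN)) distrC; exact: Hy.
  by rewrite (minn_idPr Nn) (minn_idPr (leqW Nn)) subrr normr0.
(* This is the window [|a| <= m] of the local lower bound. *)
have drift n m : (0 < n)%N -> `|y' (n + m)%N - y' n| <= m%:Z.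
  move=> n0; elim: m => [|m IH]; first by rewrite addn0 subrr normr0.
  have := step (n + m)%N; rewrite addn_gt0 n0 addnS => /(_ isT) S.
  have -> : y' (n + m).+1 - y' n = (y' (n + m).+1 - y' (n + m)%N) + (y' (n + m)%N - y' n) by ring.
  apply: le_trans (ler_normD _ _) _; rewrite intS; exact: lerD.
rewrite hit_probE // (eq_bigr (fun x : 'I_N => hit_rec N (residue_law P X N) y' N 0 x%:Z)); last first.
  move=> x _; apply: hit_rec_eq => i; rewrite add0n => /andP[_ iN].
  by rewrite /y' (minn_idPl iN).
have prge := residue_law_ge0 P X N.
have -> : 2 / k / ln N%:R = 2 / (k * ln N%:R) by rewrite -mulrA -invfM.
apply: mean_hit_le => //; first exact: sum_residue_law.
  exact: mulr_gt0.
move=> n.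
have V0 : 0 <= visits N (residue_law P X N) y' N n.+1 (y' n.+1).
  by apply: sumr_ge0 => i _; exact: (conv_pow_ge0 N prge i.+1).
(* For [N < m0] the hit alone suffices, as [k * ln N <= k * ln m0 <= 1]. Otherwise the visits at
   lags from [m0] on supply the remaining [k * (ln N - ln m0)]. *)
have [Nm|mN] := ltnP N m0.
  apply: ler_wpDr => //; apply: le_trans km; rewrite ler_wpM2l ?(ltW k0) //.
  by rewrite ler_ln ?posrE ?ltr0n // ler_nat ltnW.
suff : k * (ln N%:R - ln m0%:R) <= visits N (residue_law P X N) y' N n.+1 (y' n.+1).
  by rewrite mulrBr; lra.
apply: le_trans (ler_wpM2l (ltW k0) (harmonic_ge R m00 mN)) _.
pose g m := conv_pow N (residue_law P X N) m (y' (n.+1 + m)%N - y' n.+1).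
have -> : visits N (residue_law P X N) y' N n.+1 (y' n.+1) = \sum_(1 <= m < N.+1) g m.
  by rewrite big_add1 big_mkord.
rewrite [leRHS](@big_cat_nat _ _ _ m0) //=; last exact: leqW.
apply: ler_wpDl; first by apply: sumr_ge0 => i _; exact: conv_pow_ge0.
rewrite big_nat_recr //=; apply: ler_wpDr; first exact: conv_pow_ge0.
rewrite mulr_sumr [leLHS]big_nat [leRHS]big_nat; apply: ler_sum => m /andP[m0m mlN].
apply: (@le_trans _ _ (kap / m%:R)); first by rewrite ler_wpM2r ?invr_ge0.
apply: HL => //; last exact: drift.
- by move=> j; exact: residue_law_sin.
- by move=> j; exact: phi_re_angle.
- exact: ltnW.
Qed.

End RabbitBounds.

Theorem theorem1 (d : measure_display) (T : measurableType d) (R : realType)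
  (P : probability T R) (X : nat -> T -> int) :
  iid_discrete_rvs X -> iid_ident_distr P X -> iid_mutually_indep P X ->
  strongly_aperiodic (step_law P X) -> symmetric_law (step_law P X) ->
  forall beta cst eps : R, A3 (step_law P X) beta cst eps ->
  [/\ (beta < 1 ->
        exists c1 : R, 0 < c1 /\
          forall (N : nat) (y : nat -> int), (2 <= N)%N ->
            (forall n, (1 <= n)%N -> (n < N)%N -> `|y n - y n.+1| <= 1) ->
            c1 <= hit_prob P X N y),
      (beta = 1 ->
        exists c2 c3 : R, 0 < c2 /\ 0 < c3 /\
          forall (N : nat) (y : nat -> int), (2 <= N)%N ->
            (forall n, (1 <= n)%N -> (n < N)%N -> `|y n - y n.+1| <= 1) ->
            (1 / ((cst * pi)^-1 * ln (N%:R) + c2) <= hit_prob P X N y /\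
             hit_prob P X N y <= c3 / ln (N%:R)))
    & (1 < beta ->
        exists c4 : R, 0 < c4 /\
          forall (N : nat) (y : nat -> int), (2 <= N)%N ->
            (forall n, (1 <= n)%N -> (n < N)%N -> `|y n - y n.+1| <= 1) ->
            c4 / (N%:R `^ ((beta - 1) / beta)) <= hit_prob P X N y)].
Proof.
move=> Xm Xid Xind aper sym beta cst eps HA3; split.
- move=> b1; have [c1 [c10 H]] := hit_prob_lower_lt1 Xm Xid Xind aper sym HA3 b1.
  by exists c1; split => // N y N2 _; exact: H.
- move=> b1; have [c2 [c20 H2]] := hit_prob_lower_eq1 Xm Xid Xind aper sym HA3 b1.
  have [c3 [c30 H3]] := hit_prob_upper_eq1 Xm Xid Xind aper sym HA3 b1.
  by exists c2, c3; split => //; split => // N y N2 Hy; split; [exact: H2|exact: H3].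
- move=> b1; have [c4 [c40 H]] := hit_prob_lower_gt1 Xm Xid Xind aper sym HA3 b1.
  by exists c4; split => // N y N2 _; exact: H.
Qed.
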